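(* Let $L$ be a finite-dimensional $\mathbf U^\imath$-module and $M$ a finite-dimensional $\mathbf U$-module. Then, as linear operators on $L\otimes M$, $$\Delta(u)\,\Theta^\imath=\Theta^\imath\,\overline\Delta(u),\qquad\text{for all }u\in\mathbf U^\imath.$$
   Context: Let $q$ be an indeterminate and fix $r\in\mathbb N=\{0,1,2,\dots\}$. Put $\mathbb I=\{-r,\dots,r\}$, $\mathbb I^\imath=\{1,\dots,r\}$, $(\varepsilon_a,\varepsilon_b)=\delta_{ab}$ for $a,b\in\{-r-\frac12,\dots,r+\frac12\}$, $\alpha_i=\varepsilon_{i-\frac12}-\varepsilon_{i+\frac12}$ ($i\in\mathbb I$), $\Pi=\{\alpha_i\}$, $\mathrm{ht}(\sum c_i\alpha_i)=\sum c_i$. $\mathbf U=\mathbf U_q(\mathfrak{sl}_{2r+2})$ is the $\mathbb Q(q)$-algebra generated by $E_{\alpha_i},F_{\alpha_i},K_{\alpha_i}^{\pm1}$ ($i\in\mathbb I$) with commuting $K$'s, $K_{\alpha_i}E_{\alpha_j}K_{\alpha_i}^{-1}=q^{(\alpha_i,\alpha_j)}E_{\alpha_j}$, $K_{\alpha_i}F_{\alpha_j}K_{\alpha_i}^{-1}=q^{-(\alpha_i,\alpha_j)}F_{\alpha_j}$, $[E_{\alpha_i},F_{\alpha_j}]=\delta_{ij}\frac{K_{\alpha_i}-K_{\alpha_i}^{-1}}{q-q^{-1}}$ and the quantum Serre relations. Coproduct: $\Delta(E_{\alpha_i})=1\otimes E_{\alpha_i}+E_{\alpha_i}\otimes K_{\alpha_i}^{-1}$,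 $\Delta(F_{\alpha_i})=F_{\alpha_i}\otimes1+K_{\alpha_i}\otimes F_{\alpha_i}$, $\Delta(K_{\alpha_i})=K_{\alpha_i}\otimes K_{\alpha_i}$. $\mathbf U^\pm$ are the subalgebras generated by the $E$'s, resp. $F$'s, with weight parts $\mathbf U^\pm_{\pm\mu}$. The bar involution $\psi$ of $\mathbf U$ is the anti-linear ($q\mapsto q^{-1}$) ring involution fixing $E_{\alpha_i},F_{\alpha_i}$ and sending $K_{\alpha_i}\mapsto K_{\alpha_i}^{-1}$. $\mathbf U^\imath$ is the $\mathbb Q(q)$-subalgebra of $\mathbf U$ generated, for $i\in\mathbb I^\imath$, by $k_{\alpha_i}^{\pm1}=(K_{\alpha_i}K_{\alpha_{-i}}^{-1})^{\pm1}$, $e_{\alpha_i}=E_{\alpha_i}+K_{\alpha_i}^{-1}F_{\alpha_{-i}}$, $f_{\alpha_i}=F_{\alpha_i}K_{\alpha_{-i}}^{-1}+E_{\alpha_{-i}}$, and by $t=E_{\alpha_0}+qF_{\alpha_0}K_{\alpha_0}^{-1}+K_{\alpha_0}^{-1}$. (The paper presents $\mathbf U^\imath$ by generators and relations and embeds it in $\mathbf U$ this way.) One has $\Delta(\mathbf U^\imath)\subset\mathbf U^\imath\otimes\mathbf U$. $\mathbf U^\imath$ has its own anti-linear bar involution $\psi_\imath$, fixing $e_{\alpha_i},f_{\alpha_i},t$ and sending $k_{\alpha_i}\mapsto k_{\alpha_i}^{-1}$. Define $\overline\Delta:\mathbf U^\imath\to\mathbf U^\imath\otimes\mathbf U$ by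 $\overline\Delta(u)=(\psi_\imath\otimes\psi)\,\Delta(\psi_\imath(u))$. The intertwiner $\Upsilon=\sum_{\mu\in\mathbb N\Pi}\Upsilon_\mu$, $\Upsilon_\mu\in\mathbf U^-_{-\mu}$ (in the completion of $\mathbf U$ with respect to $\mathbf U^+\mathbf U^0\sum_{\mathrm{ht}(\mu)\ge N}\mathbf U^-_{-\mu}$), is the unique such element with $\Upsilon_0=1$ and $\psi_\imath(u)\Upsilon=\Upsilon\psi(u)$ for all $u\in\mathbf U^\imath$. Lusztig's quasi-$\mathcal R$-matrix is $\Theta=\sum_{\mu\in\mathbb N\Pi}\Theta_\mu$, $\Theta_\mu\in\mathbf U^+_\mu\otimes\mathbf U^-_{-\mu}$, $\Theta_0=1\otimes1$, the unique such element with $\Delta(u)\Theta=\Theta\,(\psi\otimes\psi)\Delta(\psi(u))$ for all $u\in\mathbf U$. The quasi-$\mathcal R$-matrix of $(\mathbf U,\mathbf U^\imath)$ is $\Theta^\imath=\Delta(\Upsilon)\,\Theta\,(\Upsilon^{-1}\otimes1)$. Write $\Theta^\imath=\sum_{N\ge0}\Theta^\imath_N$, where $\Theta^\imath_N$ is the component whose second tensor factor lies in $\bigoplus_{\mathrm{ht}(\mu)=N}\mathbf U^-_{-\mu}$; it is a fact that $\Theta^\imath_N\in\mathbf U^\imath\otimes\mathbf U^-$. So $\Theta^\imath$ lies in the completion of $\mathbf U^\imath\otimes\mathbf U^-$ with respect to the subspaces $\mathbf U^\imath\otimes\sum_{\mathrm{ht}(\mu)\ge N}\mathbf U^-_{-\mu}$,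 and it acts on $L\otimes M$ for any $\mathbf U^\imath$-module $L$ and finite-dimensional $\mathbf U$-module $M$ (only finitely many terms act nontrivially on a given vector). *)

(* Defs.v *)
From HB Require Import structures.
From mathcomp Require Import all_boot all_order all_algebra finmap.
From mathcomp Require Import boolp classical_sets cardinality fsbigop.
From mathcomp Require Import monalg.

Set Implicit Arguments.
Unset Strict Implicit.
Unset Printing Implicit Defensive.

Import GRing.Theory.
Local Open Scope ring_scope.
Local Open Scope quotient_scope.
Section Tensor.
Variables (F : fieldType) (V W : lmodType F).

(* [V (x) W] is the free abelian group on [V * W] modulo the subgroup below. *)
Inductive tens_rel : {malg int[(V * W)%type]} -> Prop :=
| tens_rel0 : tens_rel 0
| tens_relB x y : tens_rel x -> tens_rel y -> tens_rel (x - y)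
| tens_relDl v v' w : tens_rel (<<(v + v', w)>> - <<(v, w)>> - <<(v', w)>>)
| tens_relDr v w w' : tens_rel (<<(v, w + w')>> - <<(v, w)>> - <<(v, w')>>)
| tens_relZ c v w : tens_rel (<<(c *: v, w)>> - <<(v, c *: w)>>).

Definition tens_sub : {pred {malg int[(V * W)%type]}} :=
  fun x => `[< tens_rel x >].

Fact tens_sub_closed : zmod_closed tens_sub.
Proof.
split=> [|x y /asboolP Hx /asboolP Hy]; apply/asboolP; first exact: tens_rel0.
exact: tens_relB.
Qed.

HB.instance Definition _ := GRing.isZmodClosed.Build _ tens_sub tens_sub_closed.

Definition tens : Type := Quotient.quot tens_sub.
HB.instance Definition _ := GRing.Zmodule.on tens.

Definition tpi (x : {malg int[(V * W)%type]}) : tens :=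
  \pi_(Quotient.quot tens_sub) x.

Definition trepr (x : tens) : {malg int[(V * W)%type]} :=
  repr (x : Quotient.quot tens_sub).

Fact tpi_additive : zmod_morphism tpi.
Proof. by move=> x y; rewrite /tpi raddfB. Qed.

HB.instance Definition _ := GRing.isZmodMorphism.Build _ _ tpi tpi_additive.

Lemma treprK : cancel trepr tpi.
Proof. by move=> x; rewrite /tpi reprK. Qed.

Lemma tpi_eq x y : tens_rel (x - y) -> tpi x = tpi y.
Proof. by move=> h; apply/eqmodP/asboolP. Qed.

Lemma tpi_rel x y : tpi x = tpi y -> tens_rel (x - y).
Proof. by move=> /eqmodP/asboolP. Qed.

Definition tpure (v : V) (w : W) : tens := tpi <<(v, w)>>.

Lemma tpureDl v v' w : tpure (v + v') w = tpure v w + tpure v' w.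
Proof.
rewrite -raddfD; apply: tpi_eq.
by rewrite opprD addrA; exact: tens_relDl.
Qed.

Lemma tpureDr v w w' : tpure v (w + w') = tpure v w + tpure v w'.
Proof.
rewrite -raddfD; apply: tpi_eq.
by rewrite opprD addrA; exact: tens_relDr.
Qed.

Lemma tpureZ c v w : tpure (c *: v) w = tpure v (c *: w).
Proof. by apply: tpi_eq; exact: tens_relZ. Qed.

(* The additive map [tens -> Z] induced by a balanced [phi : V -> W -> Z]; see
   [tlift_pure]. It is computed on representatives, so only meaningful then. *)
Definition balanced (Z : zmodType) (phi : V -> W -> Z) : Prop :=
  [/\ forall v v' w, phi (v + v') w = phi v w + phi v' w,
      forall v w w', phi v (w + w') = phi v w + phi v w'
    & forall c v w, phi (c *: v) w = phi v (c *: w)].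

Definition tfree_eval (Z : zmodType) (phi : V -> W -> Z)
    (x : {malg int[(V * W)%type]}) : Z :=
  \sum_(p <- msupp x) phi p.1 p.2 *~ x@_p.

Definition tlift (Z : zmodType) (phi : V -> W -> Z) (x : tens) : Z :=
  tfree_eval phi (repr (x : Quotient.quot tens_sub)).

Section TliftTheory.
Variables (Z : zmodType) (phi : V -> W -> Z).

Lemma tfree_evalE (d : {fset (V * W)%type}) x : (msupp x `<=` d)%fset ->
  tfree_eval phi x = \sum_(p <- d) phi p.1 p.2 *~ x@_p.
Proof.
move=> le; rewrite /tfree_eval (big_fset_incl _ le) => //= p _ /mcoeff_outdom ->.
by rewrite mulr0z.
Qed.

Lemma tfree_evalB : zmod_morphism (tfree_eval phi).
Proof.
move=> x y; pose d := (msupp x `|` msupp y `|` msupp (x - y))%fset.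
have dx : (msupp x `<=` d)%fset by rewrite /d -fsetUA fsubsetUl.
have dy : (msupp y `<=` d)%fset by rewrite /d fsubsetU // fsubsetUr.
rewrite (tfree_evalE dx) (tfree_evalE dy) (@tfree_evalE d) ?fsubsetUr //.
by rewrite -sumrB; apply: eq_bigr => p _; rewrite mcoeffB mulrzBr.
Qed.

HB.instance Definition _ :=
  GRing.isZmodMorphism.Build _ _ (tfree_eval phi) tfree_evalB.

Lemma tfree_evalU v w : tfree_eval phi <<(v, w)>> = phi v w.
Proof.
by rewrite (tfree_evalE msuppU_le) big_seq_fset1 mcoeffUU /= mulr1z.
Qed.

Hypothesis bal : balanced phi.

Lemma tfree_eval_rel x : tens_rel x -> tfree_eval phi x = 0.
Proof.
case: bal => hDl hDr hZ.
elim=> [|y z _ hy _ hz|v v' w|v w w'|c v w]; rewrite ?raddf0 // !raddfB /=.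
- by rewrite hy hz subrr.
- by rewrite !tfree_evalU hDl -addrA -opprD subrr.
- by rewrite !tfree_evalU hDr -addrA -opprD subrr.
- by rewrite !tfree_evalU hZ subrr.
Qed.

Lemma tlift_pi x : tlift phi (tpi x) = tfree_eval phi x.
Proof.
apply/eqP; rewrite -subr_eq0 -raddfB /=; apply/eqP/tfree_eval_rel/tpi_rel.
exact: treprK.
Qed.

Lemma tlift_pure v w : tlift phi (tpure v w) = phi v w.
Proof. by rewrite tlift_pi tfree_evalU. Qed.

Lemma tliftB : zmod_morphism (tlift phi).
Proof.
move=> x y; rewrite -[x]treprK -[y]treprK -raddfB !tlift_pi.
exact: raddfB.
Qed.

Lemma tliftD x y : tlift phi (x + y) = tlift phi x + tlift phi y.
Proof.
rewrite -[x]treprK -[y]treprK -raddfD !tlift_pi.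
exact: raddfD.
Qed.

End TliftTheory.

Lemma tens_ind (P : tens -> Prop) :
  P 0 -> (forall x y, P x -> P y -> P (x - y)) -> (forall v w, P (tpure v w)) ->
  forall x, P x.
Proof.
move=> P0 PB Pp x; rewrite -[x]treprK; move: (trepr _) => {}x.
rewrite [x]monalgE raddf_sum /=; elim: (enum_fset _) => [|p s IH].
  by rewrite big_nil.
have PN y : P y -> P (- y) by rewrite -[- y]add0r; exact: PB.
have PD y z : P y -> P z -> P (y + z).
  by move=> Py Pz; rewrite -[z]opprK; exact/PB/PN.
rewrite big_cons; apply: (PD _ _ _ IH).
have Pn n : P (tpi <<n%:Z *g p>>).
  elim: n => [|n IHn]; first by rewrite monalgU0 raddf0.
  rewrite -addn1 PoszD monalgUD raddfD; apply: (PD _ _ IHn).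
  by case: (p) => v w; exact: Pp.
case: (x@_p) => n //.
by rewrite NegzE monalgUN raddfN; exact/PN/Pn.
Qed.

End Tensor.

Arguments tpure {F V W} v w.
Arguments tlift {F V W Z} phi x.

Section TensorLmodule.
Variables (F : fieldType) (V W : lmodType F).

Fact tscale_balanced c : balanced (fun (v : V) (w : W) => tpure (c *: v) w).
Proof.
split=> [v v' w|v w w'|a v w]; first by rewrite scalerDr tpureDl.
  by rewrite tpureDr.
by rewrite scalerA mulrC -scalerA tpureZ.
Qed.

Definition tscale c : tens V W -> tens V W :=
  tlift (fun v w => tpure (c *: v) w).

Lemma tscale_pure c v w : tscale c (tpure v w) = tpure (c *: v) w.
Proof. exact: tlift_pure (tscale_balanced c) v w. Qed.

Lemma tscaleB c : zmod_morphism (tscale c).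
Proof. exact: tliftB (tscale_balanced c). Qed.

HB.instance Definition _ c :=
  GRing.isZmodMorphism.Build _ _ (tscale c) (tscaleB c).

Fact tscaleA a b x : tscale a (tscale b x) = tscale (a * b) x.
Proof.
elim/tens_ind: x => [|x y hx hy|v w]; first by rewrite !raddf0.
  by rewrite !raddfB /= hx hy.
by rewrite !tscale_pure scalerA.
Qed.

Fact tscale1 : left_id 1 tscale.
Proof.
elim/tens_ind=> [|x y hx hy|v w]; first by rewrite raddf0.
  by rewrite raddfB /= hx hy.
by rewrite tscale_pure scale1r.
Qed.

Fact tscaleDr : right_distributive tscale +%R.
Proof. by move=> c x y; rewrite raddfD. Qed.

Fact tscaleDl x : {morph tscale^~ x : a b / a + b}.
Proof.
move=> a b; elim/tens_ind: x => [|x y hx hy|v w].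
- by rewrite !raddf0 addr0.
- by rewrite !raddfB /= hx hy opprD addrACA.
- by rewrite !tscale_pure scalerDl tpureDl.
Qed.

HB.instance Definition _ := GRing.Zmodule_isLmodule.Build F (tens V W)
  tscaleA tscale1 tscaleDr tscaleDl.

Lemma tpureZl c (v : V) (w : W) : tpure (c *: v) w = c *: tpure v w.
Proof. by rewrite -[RHS]/(tscale c _) tscale_pure. Qed.

End TensorLmodule.

Section TensorMap.
Variables (F : fieldType) (V W V' W' : lmodType F).

(* [f (x) g], for [f] and [g] both linear, or both anti-linear. *)
Definition tmap (f : V -> V') (g : W -> W') : tens V W -> tens V' W' :=
  tlift (fun v w => tpure (f v) (g w)).

Lemma tmap_balanced (s : F -> F) (f : V -> V') (g : W -> W') :
  {morph f : u v / u + v} -> {morph g : u v / u + v} ->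
  (forall c v, f (c *: v) = s c *: f v) ->
  (forall c w, g (c *: w) = s c *: g w) ->
  balanced (fun v w => tpure (f v) (g w)).
Proof.
move=> fD gD fZ gZ; split=> [v v' w|v w w'|c v w].
- by rewrite fD tpureDl.
- by rewrite gD tpureDr.
- by rewrite fZ gZ tpureZ.
Qed.

End TensorMap.

Section TensorAlgebra.
Variables (F : fieldType) (A B : algType F).
Local Notation T := (tens A B).

Definition tmulp (a : A) (b : B) : T -> T :=
  tlift (fun c d => tpure (a * c) (b * d)).

Fact tmulp_balanced a b : balanced (fun c d => tpure (a * c) (b * d) : T).
Proof.
split=> [v v' w|v w w'|c v w]; rewrite ?mulrDr ?tpureDl ?tpureDr //.
by rewrite -scalerAr tpureZ scalerAr.
Qed.

Lemma tmulp_pure a b c d : tmulp a b (tpure c d) = tpure (a * c) (b * d).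
Proof. exact: tlift_pure (tmulp_balanced a b) c d. Qed.

Lemma tmulpB a b : zmod_morphism (tmulp a b).
Proof. exact: tliftB (tmulp_balanced a b). Qed.

HB.instance Definition _ a b :=
  GRing.isZmodMorphism.Build _ _ (tmulp a b) (tmulpB a b).

Fact tmul_balanced y : balanced (fun a b => tmulp a b y).
Proof.
split=> [v v' w|v w w'|c v w]; elim/tens_ind: y => [|x y hx hy|a b].
- by rewrite !raddf0 addr0.
- by rewrite !raddfB /= hx hy opprD addrACA.
- by rewrite !tmulp_pure mulrDl tpureDl.
- by rewrite !raddf0 addr0.
- by rewrite !raddfB /= hx hy opprD addrACA.
- by rewrite !tmulp_pure mulrDl tpureDr.
- by rewrite !raddf0.
- by rewrite !raddfB /= hx hy.
- by rewrite !tmulp_pure -!scalerAl tpureZ.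
Qed.

Definition tmul (x y : T) : T := tlift (fun a b => tmulp a b y) x.

Lemma tmul_pure a b c d :
  tmul (tpure a b) (tpure c d) = tpure (a * c) (b * d).
Proof. by rewrite /tmul (tlift_pure (tmul_balanced _)) tmulp_pure. Qed.

Definition tmulr (y x : T) : T := tmul x y.

Fact tmulrB y : zmod_morphism (tmulr y).
Proof. exact: tliftB (tmul_balanced y). Qed.

HB.instance Definition _ y := GRing.isZmodMorphism.Build _ _ (tmulr y) (tmulrB y).

Fact tmul0l y : tmul 0 y = 0.
Proof. exact: (raddf0 (tmulr y)). Qed.

Fact tmulBl x y z : tmul (x - y) z = tmul x z - tmul y z.
Proof. exact: (raddfB (tmulr z)). Qed.

Fact tmulB x : zmod_morphism (tmul x).
Proof.
move=> y z; elim/tens_ind: x => [|u v hu hv|a b].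
- by rewrite !tmul0l subr0.
- by rewrite !tmulBl hu hv !opprB addrACA [RHS]addrACA [X in _ + X]addrC.
- by rewrite /tmul !(tlift_pure (tmul_balanced _)) raddfB.
Qed.

HB.instance Definition _ x := GRing.isZmodMorphism.Build _ _ (tmul x) (tmulB x).

Fact tmulDl : left_distributive tmul +%R.
Proof. by move=> x y z; exact: (raddfD (tmulr z)). Qed.

Fact tmulDr : right_distributive tmul +%R.
Proof. by move=> x y z; exact: (raddfD (tmul x)). Qed.

Fact tmulA : associative tmul.
Proof.
move=> x y z; elim/tens_ind: x => [|x x' hx hx'|a b].
- by rewrite !tmul0l.
- by rewrite !tmulBl hx hx'.
elim/tens_ind: y => [|y y' hy hy'|c d].
- by rewrite tmul0l raddf0 tmul0l.
- by rewrite tmulBl !raddfB /= tmulBl hy hy'.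
elim/tens_ind: z => [|z z' hz hz'|e f].
- by rewrite !raddf0.
- by rewrite !raddfB /= hz hz'.
by rewrite !tmul_pure !mulrA.
Qed.

Fact tmul1l : left_id (tpure 1 1) tmul.
Proof.
elim/tens_ind=> [|x y hx hy|a b]; first by rewrite raddf0.
  by rewrite raddfB /= hx hy.
by rewrite tmul_pure !mul1r.
Qed.

Fact tmul1r : right_id (tpure 1 1) tmul.
Proof.
elim/tens_ind=> [|x y hx hy|a b]; first by rewrite tmul0l.
  by rewrite tmulBl hx hy.
by rewrite tmul_pure !mulr1.
Qed.

Fact tscalerAl (c : F) (x y : T) : c *: tmul x y = tmul (c *: x) y.
Proof.
elim/tens_ind: x => [|x x' hx hx'|a b].
- by rewrite scaler0 tmul0l scaler0.
- by rewrite tmulBl !scalerBr tmulBl hx hx'.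
elim/tens_ind: y => [|y y' hy hy'|d e].
- by rewrite !raddf0.
- by rewrite !raddfB /= hy hy'.
by rewrite -tpureZl !tmul_pure -tpureZl -scalerAl.
Qed.

Fact tscalerAr (c : F) (x y : T) : c *: tmul x y = tmul x (c *: y).
Proof.
elim/tens_ind: x => [|x x' hx hx'|a b].
- by rewrite !tmul0l scaler0.
- by rewrite !tmulBl !scalerBr hx hx'.
elim/tens_ind: y => [|y y' hy hy'|d e].
- by rewrite !(raddf0, scaler0).
- by rewrite raddfB !scalerBr raddfB /= hy hy'.
by rewrite -tpureZl !tmul_pure -tpureZl -scalerAr.
Qed.

End TensorAlgebra.

(* A linear form with value 1 at the unit, to show [1 (x) 1 != 0]. *)
Lemma exists_unital_form (F : fieldType) (A : algType F) :
  exists f : A -> F, [/\ forall x y, f (x + y) = f x + f y,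
    forall c x, f (c *: x) = c * f x & f 1 = 1].
Proof.
pose P (S : set A) := [/\ forall c x y, S x -> S y -> S (c *: x + y) & ~ S 1].
have [G PG totG|S [[Slin S1] Smax]] := @Zorn_bigcup A P.
  split=> [c x y [X GX Xx] [Y GY Yy]|[X GX X1]]; last by case: (PG X GX).
  have [XY|YX] := totG X Y GX GY.
    by exists Y => //; case: (PG Y GY) => h _; apply: h => //; exact: XY.
  by exists X => //; case: (PG X GX) => h _; apply: h => //; exact: YX.
have [|S0] := pselect (S 0); last first.
  exfalso; apply: (Smax [set 0]%classic); last first.
    split=> [c x y -> ->|/eqP]; last by rewrite oner_eq0.
    by rewrite scaler0 addr0.
  split=> [x Sx|/(_ 0 erefl)//]; exfalso; apply: S0.
  by have := Slin (-1) x x Sx Sx; rewrite scaleN1r addNr.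
move=> S0.
have SZ c x : S x -> S (c *: x) by move=> Sx; rewrite -[_ *: _]addr0; exact: Slin.
have SD x y : S x -> S y -> S (x + y).
  by move=> Sx Sy; rewrite -[x]scale1r; exact: Slin.
have dec x : exists c : F, S (x - c *: 1).
  have [Sx|nSx] := pselect (S x); first by exists 0; rewrite scale0r subr0.
  pose S' := [set y | exists c : F, S (y - c *: x)]%classic.
  have S'lin c y z : S' y -> S' z -> S' (c *: y + z).
    move=> [a Ha] [b Hb]; exists (c * a + b).
    rewrite scalerDl opprD addrACA; apply: SD Hb.
    by rewrite -scalerA -scalerBr; exact: SZ.
  have S'S : (S `<` S')%classic.
    split=> [y Sy|/(_ x)h]; first by exists 0; rewrite scale0r subr0.
    by apply/nSx/h; exists 1; rewrite scale1r subrr.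
  have [c Hc] : S' 1.
    by apply: contrapT => nS'1; apply: (Smax S' S'S).
  have c0 : c != 0.
    by apply: contra_notN S1 => /eqP c0; move: Hc; rewrite c0 scale0r subr0.
  exists c^-1; have := SZ (- c^-1) _ Hc.
  by rewrite scalerBr scalerA mulNr mulVf // scaleN1r opprK addrC scaleNr.
have uniq x c d : S (x - c *: 1) -> S (x - d *: 1) -> c = d.
  move=> Hc Hd; apply/eqP; apply: contrapT => /negP ncd; apply: S1.
  have E : (x - d *: 1) + (-1) *: (x - c *: 1) = (c - d) *: 1.
    by rewrite scaleN1r opprB addrC addrA subrK scalerBl.
  have := SZ (c - d)^-1 _ (SD _ _ Hd (SZ (-1) _ Hc)).
  by rewrite E scalerA mulVf ?scale1r // subr_eq0.
pose f x := projT1 (cid (dec x)).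
have fP x : S (x - f x *: 1) by rewrite /f; case: cid.
exists f; split=> [x y|c x|].
- apply: (uniq (x + y)) => //.
  by rewrite scalerDl opprD addrACA; exact: SD.
- apply: (uniq (c *: x)) => //.
  by rewrite -scalerA -scalerBr; exact: SZ.
- by apply: (uniq 1) => //; rewrite scale1r subrr.
Qed.

Section TensorAlgType.
Variables (F : fieldType) (A B : algType F).

Fact tone_neq0 : tpure 1 1 != 0 :> tens A B.
Proof.
have [f [fD fZ f1]] := exists_unital_form A.
have [g [gD gZ g1]] := exists_unital_form B.
have bal : balanced (fun a b => f a * g b).
  split=> [v v' w|v w w'|c v w]; first by rewrite fD mulrDl.
    by rewrite gD mulrDr.
  by rewrite fZ gZ mulrCA mulrA.
apply/eqP => E; have := tlift_pure bal 1 1.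
rewrite E -[0](subrr 0) (tliftB bal) subrr f1 g1 mulr1 => /esym/eqP.
by rewrite oner_eq0.
Qed.

HB.instance Definition _ := GRing.Zmodule_isNzRing.Build (tens A B)
  (@tmulA F A B) (@tmul1l F A B) (@tmul1r F A B) (@tmulDl F A B)
  (@tmulDr F A B) tone_neq0.

HB.instance Definition _ :=
  GRing.Lmodule_isLalgebra.Build F (tens A B) (@tscalerAl F A B).

HB.instance Definition _ :=
  GRing.Lalgebra_isAlgebra.Build F (tens A B) (@tscalerAr F A B).

End TensorAlgType.

Section Generalities.
Variable F : fieldType.

Inductive lspan (V : lmodType F) (S : V -> Prop) : V -> Prop :=
| lspan0 : lspan S 0
| lspan_lin c x y : S x -> lspan S y -> lspan S (c *: x + y).

Inductive subalg (A : algType F) (S : A -> Prop) : A -> Prop :=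
| subalg_gen x : S x -> subalg S x
| subalg1 : subalg S 1
| subalg_lin c x y : subalg S x -> subalg S y -> subalg S (c *: x + y)
| subalgM x y : subalg S x -> subalg S y -> subalg S (x * y).

Definition tspan (V W : lmodType F) (S : V -> Prop) (T : W -> Prop) :
    tens V W -> Prop :=
  lspan (fun x => exists v w, [/\ S v, T w & x = tpure v w]).

(* Elements of the completion of [V] with respect to a decreasing family of
   subspaces [H N] are represented by Cauchy sequences in [V], an infinite sum by
   the sequence of its partial sums; [ceq H] is equality in the completion. The
   operations of a completed algebra are pointwise. *)
Definition cauchy (V : lmodType F) (H : nat -> V -> Prop) (s : nat -> V) :=
  forall N, exists n0, forall m n, (n0 <= m)%N -> (n0 <= n)%N ->
    H N (s m - s n).

Definition ceq (V : lmodType F) (H : nat -> V -> Prop) (s t : nat -> V) :=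
  forall N, exists n0, forall n, (n0 <= n)%N -> H N (s n - t n).

Definition cinverse (A : algType F) (H : nat -> A -> Prop) (s t : nat -> A) :=
  [/\ cauchy H t, ceq H (fun n => s n * t n) (fun=> 1)
    & ceq H (fun n => t n * s n) (fun=> 1)].

Record is_module (A : algType F) (V : lmodType F) (act : A -> V -> V) := {
  module_linl : forall v, linear (act^~ v);
  module_linr : forall a, linear (act a);
  module_1 : forall v, act 1 v = v;
  module_M : forall a b v, act (a * b) v = act a (act b v)
}.

Definition tact (A B : algType F) (L M : lmodType F)
    (actL : A -> L -> L) (actM : B -> M -> M) (x : tens A B) (v : tens L M) :
    tens L M :=
  tlift (fun a b => tmap (actL a) (actM b) v) x.

End Generalities.

Section QuantumGroup.
Variables (k : fieldType) (q : k) (bar : k -> k) (r : nat).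

(* Below [k] and [q] are arbitrary; the case of interest is [k = Q(q)], [bar] the
   automorphism [q |-> q^-1] (see [Qq], [q], [qbar] at the end of the file).
   [i : Idx] stands for the element [i - r] of {-r, .., r}. *)
Notation Idx := 'I_(r.*2.+1).

Definition idx0 : Idx := inord r.
Definition idxp (i : 'I_r) : Idx := inord (r + i.+1).
Definition idxn (i : 'I_r) : Idx := inord (r - i.+1).

Definition alpha (i : Idx) : 'rV[int]_(r.*2.+2) :=
  delta_mx 0 (inord i) - delta_mx 0 (inord i.+1).
Definition form (u v : 'rV[int]_(r.*2.+2)) : int := \sum_j u 0 j * v 0 j.

(* [mu : NPi] stands for [\sum_i mu_i alpha_i]. *)
Definition NPi := {ffun Idx -> nat}.
Definition wt (mu : NPi) : 'rV[int]_(r.*2.+2) := \sum_i alpha i *+ mu i.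
Definition NPi0 : NPi := [ffun=> 0%N].
Definition ht (mu : NPi) : nat := (\sum_i mu i)%N.

Inductive qgen := GenE of Idx | GenF of Idx | GenK of Idx | GenKV of Idx.

Definition qgen_code (g : qgen) : (Idx + Idx) + (Idx + Idx) :=
  match g with
  | GenE i => inl (inl i) | GenF i => inl (inr i)
  | GenK i => inr (inl i) | GenKV i => inr (inr i)
  end.
Definition qgen_decode (x : (Idx + Idx) + (Idx + Idx)) : qgen :=
  match x with
  | inl (inl i) => GenE i | inl (inr i) => GenF i
  | inr (inl i) => GenK i | inr (inr i) => GenKV i
  end.
Fact qgen_codeK : cancel qgen_code qgen_decode. Proof. by case. Qed.
HB.instance Definition _ := Choice.copy qgen (can_type qgen_codeK).

Notation FA := {malg k[{fmonom qgen}]}.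
Definition fgen : qgen -> FA := locked (fun g => << fmu g >>).
Local Notation fE i := (fgen (GenE i)).
Local Notation fF i := (fgen (GenF i)).
Local Notation fK i := (fgen (GenK i)).
Local Notation fKV i := (fgen (GenKV i)).

Inductive Urel : FA -> FA -> Prop :=
| Urel_KKV i : Urel (fK i * fKV i) 1
| Urel_KVK i : Urel (fKV i * fK i) 1
| Urel_KK i j : Urel (fK i * fK j) (fK j * fK i)
| Urel_KE i j :
    Urel (fK i * fE j * fKV i) (q ^ form (alpha i) (alpha j) *: fE j)
| Urel_KF i j :
    Urel (fK i * fF j * fKV i) (q ^ (- form (alpha i) (alpha j)) *: fF j)
| Urel_EF i j :
    Urel (fE i * fF j - fF j * fE i)
         (if i == j then (q - q^-1)^-1 *: (fK i - fKV i) else 0)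
| Urel_EE i j : form (alpha i) (alpha j) = 0 ->
    Urel (fE i * fE j) (fE j * fE i)
| Urel_FF i j : form (alpha i) (alpha j) = 0 ->
    Urel (fF i * fF j) (fF j * fF i)
| Urel_serreE i j : form (alpha i) (alpha j) = -1 ->
    Urel (fE i * fE i * fE j - (q + q^-1) *: (fE i * fE j * fE i)
          + fE j * fE i * fE i) 0
| Urel_serreF i j : form (alpha i) (alpha j) = -1 ->
    Urel (fF i * fF i * fF j - (q + q^-1) *: (fF i * fF j * fF i)
          + fF j * fF i * fF i) 0.

Inductive Uideal : FA -> Prop :=
| Uideal_rel x y : Urel x y -> Uideal (x - y)
| Uideal0 : Uideal 0
| UidealB x y : Uideal x -> Uideal y -> Uideal (x - y)
| UidealMl a x : Uideal x -> Uideal (a * x)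
| UidealMr a x : Uideal x -> Uideal (x * a).

Definition Uideal_pred : {pred FA} := fun x => `[< Uideal x >].

Fact Uideal_closed : zmod_closed Uideal_pred.
Proof.
split=> [|x y /asboolP Hx /asboolP Hy]; apply/asboolP; first exact: Uideal0.
exact: UidealB.
Qed.

HB.instance Definition _ := GRing.isZmodClosed.Build _ Uideal_pred Uideal_closed.

Definition U : Type := Quotient.quot Uideal_pred.
HB.instance Definition _ := GRing.Zmodule.on U.

Definition Upi (x : FA) : U := \pi_(Quotient.quot Uideal_pred) x.
Definition Urepr (x : U) : FA := repr (x : Quotient.quot Uideal_pred).

Fact Upi_zmod_morphism : zmod_morphism Upi.
Proof. by move=> x y; rewrite /Upi raddfB. Qed.

HB.instance Definition _ := GRing.isZmodMorphism.Build _ _ Upi Upi_zmod_morphism.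

Lemma UreprK : cancel Urepr Upi.
Proof. by move=> x; rewrite /Upi reprK. Qed.

Lemma UpiP x y : Upi x = Upi y <-> Uideal (x - y).
Proof. by split=> [/eqmodP/asboolP|h] //; apply/eqmodP/asboolP. Qed.

Definition Umul : U -> U -> U :=
  locked (fun x y => Upi (Urepr x * Urepr y)).
Definition Uscale : k -> U -> U := locked (fun c x => Upi (c *: Urepr x)).

Lemma UpiM x y : Umul (Upi x) (Upi y) = Upi (x * y).
Proof.
rewrite /Umul -lock; move: (UreprK (Upi x)) (UreprK (Upi y)) => /UpiP hx /UpiP hy.
apply/UpiP; set x' := Urepr (Upi x); set y' := Urepr (Upi y).
have -> : x' * y' - x * y = x' * (y' - y) - (0 - (x' - x) * y).
  by rewrite sub0r opprK mulrBr mulrBl addrA subrK.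
apply: UidealB; first exact: UidealMl.
by apply: UidealB; [exact: Uideal0 | exact: UidealMr].
Qed.

Lemma UpiZ c x : Uscale c (Upi x) = Upi (c *: x).
Proof.
have := UreprK (Upi x); rewrite /Uscale -lock; move: (Urepr _) => x' /UpiP hx.
by apply/UpiP; rewrite -scalerBr -mul_malgC; exact: UidealMl.
Qed.

Fact UmulA : associative Umul.
Proof.
move=> x y z; rewrite -[x]UreprK -[y]UreprK -[z]UreprK.
by rewrite !UpiM mulrA.
Qed.

Fact Umul1l : left_id (Upi 1) Umul.
Proof. by move=> x; rewrite -[x]UreprK UpiM mul1r. Qed.

Fact Umul1r : right_id (Upi 1) Umul.
Proof. by move=> x; rewrite -[x]UreprK UpiM mulr1. Qed.

Fact UmulDl : left_distributive Umul +%R.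
Proof.
move=> x y z; rewrite -[x]UreprK -[y]UreprK -[z]UreprK.
by rewrite -raddfD !UpiM -raddfD mulrDl.
Qed.

Fact UmulDr : right_distributive Umul +%R.
Proof.
move=> x y z; rewrite -[x]UreprK -[y]UreprK -[z]UreprK.
by rewrite -raddfD !UpiM -raddfD mulrDr.
Qed.

(* The counit, used to show [1 != 0] in [U]. *)
Definition ucounit_gen (g : qgen) : k :=
  match g with GenE _ | GenF _ => 0 | GenK _ | GenKV _ => 1 end.
Definition ucounit_word (m : {fmonom qgen}) : k :=
  \prod_(g <- fmonom_val m) ucounit_gen g.

Fact ucounit_wordM : mmorphism ucounit_word.
Proof.
split=> [x y|]; rewrite /ucounit_word.
  by rewrite /mmul /= fmmulE big_cat.
by rewrite /mone /= fmoneE big_nil.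
Qed.

HB.instance Definition _ :=
  monalg.isMultiplicative.Build _ _ ucounit_word ucounit_wordM.

Definition ucounit (x : FA) : k := mmap idfun ucounit_word x.

Fact ucounit_zmod_morphism : zmod_morphism ucounit.
Proof. exact: mmapB. Qed.

Fact ucounit_monoid_morphism : monoid_morphism ucounit.
Proof.
have [H _] := mmap_is_multiplicative (f := idfun) (h := ucounit_word).
by split; [exact: mmap1 | exact: H].
Qed.

HB.instance Definition _ :=
  GRing.isZmodMorphism.Build FA k ucounit ucounit_zmod_morphism.
HB.instance Definition _ :=
  GRing.isMonoidMorphism.Build FA k ucounit ucounit_monoid_morphism.

Lemma ucounitZ c x : ucounit (c *: x) = c * ucounit x.
Proof. by rewrite /ucounit mmapZ. Qed.

Lemma ucounit_fgen g : ucounit (fgen g) = ucounit_gen g.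
Proof.
by rewrite /ucounit /fgen -lock mmapU /= mul1r /ucounit_word fmuE big_cons big_nil mulr1.
Qed.

Fact serre0 (A : lalgType k) (f : {rmorphism A -> k}) c (a b : A) :
  (forall d x, f (d *: x) = d * f x) -> f a = 0 ->
  f (a * a * b - c *: (a * b * a) + b * a * a) = 0.
Proof.
move=> fZ fa; rewrite rmorphD rmorphB fZ !rmorphM fa.
by rewrite !mulr0 !mul0r subr0 addr0.
Qed.

Lemma ucounit_ideal x : Uideal x -> ucounit x = 0.
Proof.
elim=> [{}x y h||{}x y _ hx _ hy|a {}x _ hx|a {}x _ hx]; rewrite ?rmorph0 //.
- have ucM a b : ucounit (a * b) = ucounit a * ucounit b by exact: rmorphM.
  have ucB a b : ucounit (a - b) = ucounit a - ucounit b by exact: rmorphB.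
  have ucD a b : ucounit (a + b) = ucounit a + ucounit b by exact: rmorphD.
  have uc1 : ucounit 1 = 1 by exact: rmorph1.
  have uc0 : ucounit 0 = 0 by exact: rmorph0.
  have uc2 g g' : ucounit (fgen g * fgen g') = ucounit_gen g * ucounit_gen g'.
    by rewrite ucM !ucounit_fgen.
  apply/eqP; rewrite ucB subr_eq0; apply/eqP.
  case: h => [i|i|i j|i j|i j|i j|i j _|i j _|i j _|i j _].
  + by rewrite uc2 uc1 mulr1.
  + by rewrite uc2 uc1 mulr1.
  + by apply: etrans (uc2 (GenK i) (GenK j)) _; apply/esym/uc2.
  + by rewrite ucM uc2 ucounitZ !ucounit_fgen !mulr0 mul0r.
  + by rewrite ucM uc2 ucounitZ !ucounit_fgen !mulr0 mul0r.
  + rewrite ucB; apply: etrans (congr2 (fun a b => a - b) (uc2 _ _) (uc2 _ _)) _.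
    rewrite /= mulr0 subr0.
    by case: ifP => _; rewrite ?uc0 // ucounitZ ucB !ucounit_fgen subrr mulr0.
  + by apply: etrans (uc2 (GenE i) (GenE j)) _; apply/esym/uc2.
  + by apply: etrans (uc2 (GenF i) (GenF j)) _; apply/esym/uc2.
  + rewrite uc0; apply: (@serre0 FA ucounit _ (fE i) (fE j) ucounitZ).
    exact: ucounit_fgen.
  + rewrite uc0; apply: (@serre0 FA ucounit _ (fF i) (fF j) ucounitZ).
    exact: ucounit_fgen.
- by rewrite rmorphB /= hx hy subrr.
- by rewrite rmorphM /= hx mulr0.
- by rewrite rmorphM /= hx mul0r.
Qed.

Fact Uone_neq0 : Upi 1 != 0.
Proof.
apply/eqP; rewrite -(raddf0 Upi) => /UpiP /ucounit_ideal/eqP.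
by rewrite subr0 rmorph1 oner_eq0.
Qed.

HB.instance Definition _ := GRing.Zmodule_isNzRing.Build U
  UmulA Umul1l Umul1r UmulDl UmulDr Uone_neq0.

Fact UscaleA a b x : Uscale a (Uscale b x) = Uscale (a * b) x.
Proof. by rewrite -[x]UreprK !UpiZ scalerA. Qed.

Fact Uscale1 : left_id 1 Uscale.
Proof. by move=> x; rewrite -[x]UreprK UpiZ scale1r. Qed.

Fact UscaleDr : right_distributive Uscale +%R.
Proof.
move=> c x y; rewrite -[x]UreprK -[y]UreprK.
by rewrite -raddfD !UpiZ -raddfD scalerDr.
Qed.

Fact UscaleDl x : {morph Uscale^~ x : a b / a + b}.
Proof. by move=> a b; rewrite -[x]UreprK !UpiZ -raddfD scalerDl. Qed.

HB.instance Definition _ := GRing.Zmodule_isLmodule.Build k U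
  UscaleA Uscale1 UscaleDr UscaleDl.

Fact UscalerAl (c : k) (x y : U) : c *: (x * y) = (c *: x) * y.
Proof.
rewrite -[x]UreprK -[y]UreprK -[LHS]/(Uscale c (Umul _ _)).
by rewrite -[RHS]/(Umul (Uscale c _) _) UpiM !UpiZ UpiM scalerAl.
Qed.

HB.instance Definition _ := GRing.Lmodule_isLalgebra.Build k U UscalerAl.

Fact malg_scalerAr (c : k) (x y : FA) : c *: (x * y) = x * (c *: y).
Proof.
have C : malgC c * x = x * malgC c; last first.
  rewrite -(mul_malgC c (x * y)) -(mul_malgC c y) (mulrA (malgC c) x y) C.
  exact/esym/mulrA.
rewrite -[malgC c * x]/(fgmul _ _) -[x * malgC c]/(fgmul _ _) fgmulUg fgmulgU.
by apply: eq_bigr => m _; rewrite mulrC mul1m mulm1.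
Qed.

Fact UscalerAr (c : k) (x y : U) : c *: (x * y) = x * (c *: y).
Proof.
rewrite -[x]UreprK -[y]UreprK -[LHS]/(Uscale c (Umul _ _)).
by rewrite -[RHS]/(Umul _ (Uscale c _)) UpiM !UpiZ UpiM malg_scalerAr.
Qed.

HB.instance Definition _ := GRing.Lalgebra_isAlgebra.Build k U UscalerAr.

Definition UE (i : Idx) : U := Upi (fE i).
Definition UF (i : Idx) : U := Upi (fF i).
Definition UK (i : Idx) : U := Upi (fK i).
Definition UKV (i : Idx) : U := Upi (fKV i).

Definition Uplus : U -> Prop := subalg (fun x => exists i, x = UE i).
Definition Uminus : U -> Prop := subalg (fun x => exists i, x = UF i).
Definition Uzero : U -> Prop := subalg (fun x => exists i, x = UK i \/ x = UKV i).

Definition Uplus_wt (mu : NPi) (x : U) : Prop :=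
  Uplus x /\
  forall i, UK i * x * UKV i = q ^ form (alpha i) (wt mu) *: x.
Definition Uminus_wt (mu : NPi) (x : U) : Prop :=
  Uminus x /\
  forall i, UK i * x * UKV i = q ^ (- form (alpha i) (wt mu)) *: x.

Definition Ufilt (N : nat) : U -> Prop :=
  lspan (fun x => exists a h b mu,
    [/\ Uplus a, Uzero h, Uminus_wt mu b, (N <= ht mu)%N & x = a * h * b]).

Definition UUfilt (N : nat) : tens U U -> Prop :=
  lspan (fun x => exists a b, (Ufilt N a \/ Ufilt N b) /\ x = tpure a b).

(* Partial sum of [\sum_mu X_mu] over [ht mu < n]. *)
Definition psum (V : zmodType) (X : NPi -> V) (n : nat) : V :=
  \sum_(mu \in [set mu | (ht mu < n)%N]%classic) X mu.

Definition gk (i : 'I_r) : U := UK (idxp i) * UKV (idxn i).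
Definition gkV (i : 'I_r) : U := UK (idxn i) * UKV (idxp i).
Definition ge (i : 'I_r) : U := UE (idxp i) + UKV (idxp i) * UF (idxn i).
Definition gf (i : 'I_r) : U := UF (idxp i) * UKV (idxn i) + UE (idxn i).
Definition gt : U := UE idx0 + q *: (UF idx0 * UKV idx0) + UKV idx0.

Inductive Ui_gen : U -> Prop :=
| Ui_gen_k i : Ui_gen (gk i)
| Ui_gen_kV i : Ui_gen (gkV i)
| Ui_gen_e i : Ui_gen (ge i)
| Ui_gen_f i : Ui_gen (gf i)
| Ui_gen_t : Ui_gen gt.

Definition Ui_pred : {pred U} := fun x => `[< subalg Ui_gen x >].

Fact Ui_closed : subalg_closed Ui_pred.
Proof.
split=> [|c x y|x y]; first by apply/asboolP; exact: subalg1.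
  by move=> /asboolP Hx /asboolP Hy; apply/asboolP; exact: subalg_lin.
by move=> /asboolP Hx /asboolP Hy; apply/asboolP; exact: subalgM.
Qed.

HB.instance Definition _ := GRing.isSubalgClosed.Build k U Ui_pred Ui_closed.

Record Ui := MkUi { Ui_val :> U; Ui_valP : Ui_val \in Ui_pred }.
HB.instance Definition _ := [isSub for Ui_val].
HB.instance Definition _ := [Choice of Ui by <:].
HB.instance Definition _ := [SubChoice_isSubAlgebra of Ui by <:].

Definition Ui_of (x : U) (gx : Ui_gen x) : Ui := MkUi (asboolT (subalg_gen gx)).
Definition Uik (i : 'I_r) : Ui := Ui_of (Ui_gen_k i).
Definition UikV (i : 'I_r) : Ui := Ui_of (Ui_gen_kV i).
Definition Uie (i : 'I_r) : Ui := Ui_of (Ui_gen_e i).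
Definition Uif (i : 'I_r) : Ui := Ui_of (Ui_gen_f i).
Definition Uit : Ui := Ui_of Ui_gen_t.

Definition antilinear (V W : lmodType k) (f : V -> W) : Prop :=
  forall c x, f (c *: x) = bar c *: f x.

Definition is_coproduct (Delta : {lrmorphism U -> tens U U}) : Prop :=
  [/\ forall i, Delta (UE i) = tpure 1 (UE i) + tpure (UE i) (UKV i),
      forall i, Delta (UF i) = tpure (UF i) 1 + tpure (UK i) (UF i)
    & forall i, Delta (UK i) = tpure (UK i) (UK i)].

Definition is_bar (psi : {rmorphism U -> U}) : Prop :=
  antilinear psi /\
  [/\ forall i, psi (UE i) = UE i, forall i, psi (UF i) = UF i
    & forall i, psi (UK i) = UKV i].

Definition is_ibar (psii : {rmorphism Ui -> Ui}) : Prop :=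
  antilinear psii /\
  [/\ forall i, psii (Uie i) = Uie i, forall i, psii (Uif i) = Uif i,
      psii Uit = Uit & forall i, psii (Uik i) = UikV i].

Definition is_restricted_coproduct (Delta : {lrmorphism U -> tens U U})
    (Deltai : Ui -> tens Ui U) : Prop :=
  forall u, tmap val id (Deltai u) = Delta (val u).

Definition bar_coproduct (psi : {rmorphism U -> U}) (psii : {rmorphism Ui -> Ui})
    (Deltai : Ui -> tens Ui U) (u : Ui) : tens Ui U :=
  tmap psii psi (Deltai (psii u)).

Definition is_intertwiner (psi : {rmorphism U -> U})
    (psii : {rmorphism Ui -> Ui}) (Upsilon : NPi -> U) : Prop :=
  [/\ forall mu, Uminus_wt mu (Upsilon mu), Upsilon NPi0 = 1
    & forall u : Ui,
        ceq Ufilt (fun n => val (psii u) * psum Upsilon n)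
                  (fun n => psum Upsilon n * psi (val u))].

Definition is_quasiR (Delta : {lrmorphism U -> tens U U})
    (psi : {rmorphism U -> U}) (Theta : NPi -> tens U U) : Prop :=
  [/\ forall mu, tspan (Uplus_wt mu) (Uminus_wt mu) (Theta mu),
      Theta NPi0 = tpure 1 1
    & forall u,
        ceq UUfilt (fun n => Delta u * psum Theta n)
                   (fun n => psum Theta n * tmap psi psi (Delta (psi u)))].

(* [Thetai N] is the component of [Delta(Upsilon) Theta (Upsilon^-1 (x) 1)]
   whose second factor has height [N], as an element of [Ui (x) U]. *)
Definition is_quasiRi (Delta : {lrmorphism U -> tens U U})
    (Upsilon : NPi -> U) (Upsilon_inv : nat -> U) (Theta : NPi -> tens U U)
    (Thetai : nat -> tens Ui U) : Prop :=
  (forall N, tspan (fun=> True)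
     (fun b => exists2 mu, ht mu = N & Uminus_wt mu b) (Thetai N)) /\
  ceq UUfilt
    (fun n => Delta (psum Upsilon n) * psum Theta n * tpure (Upsilon_inv n) 1)
    (fun n => \sum_(N < n) tmap val id (Thetai N)).

(* The sum is finite on each vector: [Thetai N v = 0] for [N] large when [M] is
   finite dimensional. *)
Definition quasiRi_act (L M : lmodType k) (actL : Ui -> L -> L)
    (actM : U -> M -> M) (Thetai : nat -> tens Ui U) (v : tens L M) : tens L M :=
  \sum_(N \in [set: nat]%classic) tact actL actM (Thetai N) v.

End QuantumGroup.

Section BaseField.

Definition Qq : fieldType := {fraction {poly rat}}.
Definition q : Qq := tofrac 'X.

Fact q_neq0 : q != 0.
Proof. by rewrite /q tofrac_eq0 polyX_eq0. Qed.

Definition ratQ : rat -> Qq := @tofrac {poly rat} \o polyC.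
HB.instance Definition _ := GRing.RMorphism.on ratQ.

(* The automorphism [f(q) |-> f(q^-1)] of Q(q), computed on a fraction
   representing [f]; see [qbar_frac]. *)
Definition qsubst (p : {poly rat}) : Qq := (map_poly ratQ p).[q^-1].
Definition qbar (c : Qq) : Qq :=
  let x := repr (c : {fraction {poly rat}}) in qsubst \n_x / qsubst \d_x.

Fact qsubst_zmod_morphism : zmod_morphism qsubst.
Proof. by move=> x y; rewrite /qsubst rmorphB hornerD hornerN. Qed.

Fact qsubst_monoid_morphism : monoid_morphism qsubst.
Proof.
by split=> [|x y]; rewrite /qsubst ?rmorph1 ?hornerC // rmorphM hornerM.
Qed.

HB.instance Definition _ :=
  GRing.isZmodMorphism.Build _ _ qsubst qsubst_zmod_morphism.
HB.instance Definition _ :=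
  GRing.isMonoidMorphism.Build _ _ qsubst qsubst_monoid_morphism.

Lemma qsubst_eq0 p : (qsubst p == 0) = (p == 0).
Proof.
apply/eqP/eqP => [|->]; last exact: rmorph0.
move=> E; apply/eqP; rewrite -lead_coef_eq0 /lead_coef.
set n := (size p).-1; pose s := \sum_(i < n.+1) p`_i *: 'X^(n - i).
have : q ^+ n * qsubst p = tofrac s.
  have sz : (size (map_poly ratQ p) <= n.+1)%N.
    by rewrite (leq_trans (size_poly _ _)) // /n leqSpred.
  rewrite /qsubst (horner_coef_wide _ sz) mulr_sumr rmorph_sum.
  apply: eq_bigr => i _; rewrite coef_map -mul_polyC rmorphM rmorphXn /= mulrCA.
  have le_in : (i <= n)%N by rewrite -ltnS ltn_ord.
  have qU : q \is a GRing.unit by rewrite unitfE q_neq0.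
  congr (_ * _).
  by rewrite exprVn -(exprB le_in qU).
rewrite E mulr0 => /esym/eqP; rewrite tofrac_eq0 => /eqP s0.
have := congr1 (fun r : {poly rat} => r`_0) s0.
rewrite coef0 coef_sum big_ord_recr /= subnn big1 => [|i _].
  by rewrite add0r coefZ coefXn mulr1 => ->.
by rewrite coefZ coefXn ltn_eqF ?subn_gt0 ?mulr0.
Qed.

Lemma fracE (c : {fraction {poly rat}}) :
  c = tofrac \n_(repr c) / tofrac \d_(repr c).
Proof.
have d0 : tofrac \d_(repr c) != 0 by rewrite tofrac_eq0 denom_ratioP.
apply: (mulIf d0); rewrite divfK //.
set x := repr c; rewrite -[X in X * _](reprK c) -/x; clearbody x.
rewrite -[_ * _]/(FracField.mul _ _) !piE; apply/eqmodP.
have dx := denom_ratioP x.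
by rewrite /= FracField.equivfE /FracField.mulf !numden_Ratio ?mulr1 ?oner_eq0 //
  mulrC.
Qed.

Lemma qbar_frac (a b : {poly rat}) : b != 0 ->
  qbar (tofrac a / tofrac b) = qsubst a / qsubst b.
Proof.
move=> b0; rewrite /qbar; set c := tofrac a / tofrac b.
have d0 : \d_(repr c) != 0 by exact: denom_ratioP.
have : tofrac a / tofrac b = tofrac \n_(repr c) / tofrac \d_(repr c).
  exact: fracE.
move=> /eqP; rewrite eqr_div ?tofrac_eq0 // -!tofracM tofrac_eq => /eqP E.
by apply/eqP; rewrite eqr_div ?qsubst_eq0 // -!rmorphM E mulrC.
Qed.

Lemma fracP (c : Qq) :
  exists a b : {poly rat}, b != 0 /\ c = tofrac a / tofrac b.
Proof.
exists \n_(repr (c : {fraction {poly rat}})).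
exists \d_(repr (c : {fraction {poly rat}})).
by split; [exact: denom_ratioP | exact: fracE].
Qed.

Fact qbar_zmod_morphism : zmod_morphism qbar.
Proof.
move=> x y; have [a [b [b0 ->]]] := fracP x; have [c [d [d0 ->]]] := fracP y.
rewrite -mulNr -rmorphN addf_div ?tofrac_eq0 // -!rmorphM -rmorphD.
rewrite !qbar_frac ?mulf_neq0 //.
by rewrite rmorphD !rmorphM rmorphN -addf_div ?qsubst_eq0 // mulNr.
Qed.

Fact qbar_monoid_morphism : monoid_morphism qbar.
Proof.
split=> [|x y].
  rewrite -[1 in LHS]divr1 -tofrac1 qbar_frac ?oner_eq0 //.
  by rewrite rmorph1 divr1.
have [a [b [b0 ->]]] := fracP x; have [c [d [d0 ->]]] := fracP y.
rewrite mulf_div -!rmorphM !qbar_frac ?mulf_neq0 //.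
by rewrite !rmorphM -mulf_div.
Qed.

HB.instance Definition _ :=
  GRing.isZmodMorphism.Build Qq Qq qbar qbar_zmod_morphism.
HB.instance Definition _ :=
  GRing.isMonoidMorphism.Build Qq Qq qbar qbar_monoid_morphism.

Fact qbar_q : qbar q = q^-1.
Proof.
rewrite -[q in LHS]divr1 -tofrac1 qbar_frac ?oner_eq0 // rmorph1 divr1.
by rewrite /qsubst map_polyX hornerX.
Qed.
End BaseField.

(* Main.v *)
(* Let F_N be the left ideal of U generated by the words of length N in the F_i,
   and G_N = F_N (x) U + U (x) F_N. Both filtrations consist of left ideals,
   right multiplication by a fixed element is continuous, and Delta is continuous,
   so in the completions one may compute
     Delta(u) Delta(Ups) Theta (Ups^-1 (x) 1)
       = Delta(Ups) Delta(psi(v)) Theta (Ups^-1 (x) 1)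
       = Delta(Ups) Theta (psi (x) psi)(Delta(v)) (Ups^-1 (x) 1)
       = Delta(Ups) Theta (Ups^-1 (x) 1) (psi_i (x) psi)(Delta(v)),
   where v = psi_i(u): this is the identity in the completion of U (x) U.

   As L is only a module over U^i, the identity must be brought back to
   U^i (x) U. Long words in the F_i act by zero on M, since ad K_{2 rho} has
   finitely many eigenvalues on End M. Hence, for a matrix coefficient c of M,
   the elements (id (x) c)(z_n) of U^i, with z_n the difference of the two sides
   cut off at height n, do not depend on n >> 0, and they lie in every F_N.
   It remains to see that the intersection of the F_N is zero. An element is a
   combination of products a g b (a a word in the E_i, g a monomial in the
   K_i^{+-1}, b a word in the F_i); the component of lowest degree of its iterated
   coproduct is the sum of the g b (x) g (x) a g over the b of maximal length,
   and w omega(y) z recovers a g b from z (x) y (x) w = g b (x) g (x) a g, with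
   omega the Chevalley involution. So the sum of the terms with b of maximal
   length vanishes as soon as the element does, whence Sum_n U^+ U^0 U^-_n is
   direct. *)
Require Import Defs.
From HB Require Import structures.
From mathcomp Require Import all_boot all_order all_algebra finmap.
From mathcomp Require Import boolp classical_sets cardinality fsbigop.
From mathcomp Require Import monalg.
From mathcomp Require Import zify.

Set Implicit Arguments.
Unset Strict Implicit.
Unset Printing Implicit Defensive.

Import Order.TTheory GRing.Theory Num.Theory.
Local Open Scope ring_scope.

(** * Spans and eigenspaces *)

Section Span.
Variables (F : fieldType) (V : lmodType F).
Implicit Types (S : V -> Prop).

Lemma lspan_comb S c x y : lspan S x -> lspan S y -> lspan S (c *: x + y).
Proof.
move=> + Sy; elim=> [|d u v Su _ IH]; first by rewrite scaler0 add0r.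
by rewrite scalerDr scalerA -addrA; exact: lspan_lin.
Qed.

Lemma lspan_gen S x : S x -> lspan S x.
Proof.
move=> Sx; rewrite -[x]scale1r -[_ *: _]addr0.
by apply: lspan_lin => //; exact: lspan0.
Qed.

Lemma lspanD S x y : lspan S x -> lspan S y -> lspan S (x + y).
Proof. by move=> Sx Sy; rewrite -[x]scale1r; exact: lspan_comb. Qed.

Lemma lspanZ S c x : lspan S x -> lspan S (c *: x).
Proof.
by move=> Sx; rewrite -[_ *: _]addr0; apply: lspan_comb => //; exact: lspan0.
Qed.

Lemma lspanB S x y : lspan S x -> lspan S y -> lspan S (x - y).
Proof. by move=> Sx Sy; rewrite addrC -scaleN1r; apply: lspan_comb. Qed.

End Span.

Lemma lspan_map (F : fieldType) (V W : lmodType F) (S : V -> Prop)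
    (T : W -> Prop) (f : V -> W) : linear f ->
  (forall x, S x -> lspan T (f x)) -> forall x, lspan S x -> lspan T (f x).
Proof.
move=> fL h x; elim=> [|c u v Su _ IH].
  have := fL 1 0 0; rewrite !scale1r addr0 => /eqP.
  by rewrite -{1}[f 0]addr0 (inj_eq (addrI _)) => /eqP <-; exact: lspan0.
by rewrite fL; apply: lspan_comb IH; exact: h.
Qed.

Lemma lspan_sub (F : fieldType) (V : lmodType F) (S T : V -> Prop) :
  (forall x, S x -> lspan T x) -> forall x, lspan S x -> lspan T x.
Proof. by move=> h x Sx; exact: (@lspan_map F V V S T id). Qed.

Lemma lspan_split (F : fieldType) (V : lmodType F) (S T1 T2 : V -> Prop) :
  (forall x, S x -> T1 x \/ T2 x) -> forall x, lspan S x ->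
  exists y z, [/\ lspan T1 y, lspan T2 z & x = y + z].
Proof.
move=> h x; elim=> [|c u v /h Su _ [y [z [Hy Hz ->]]]].
  by exists 0, 0; split; rewrite ?addr0 //; exact: lspan0.
case: Su => Tu.
  by exists (c *: u + y), z; split; rewrite ?addrA //; exact: lspan_lin.
by exists y, (c *: u + z); split; rewrite // 1?addrCA //; exact: lspan_lin.
Qed.

Section MulLinear.
Variables (F : fieldType) (A : algType F).

Lemma mulL_linear (z : A) : linear ( *%R z : A -> A).
Proof. by move=> c u v; rewrite mulrDr scalerAr. Qed.

Lemma mulR_linear (z : A) : linear (fun u : A => u * z).
Proof. by move=> c u v; rewrite mulrDl scalerAl. Qed.

End MulLinear.

Section Eigen.
Variables (F : fieldType) (V : lmodType F) (phi : V -> V) (lam : int -> F).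
Hypotheses (phiL : linear phi) (lamI : injective lam).

Definition eigspan (P : int -> Prop) : V -> Prop :=
  lspan (fun y => exists2 j, P j & phi y = lam j *: y).

Let op (s : seq int) (v : V) : V :=
  foldr (fun j v => phi v - lam j *: v) v s.

(** The product of the [phi - lam j], over the finitely many eigenvalues occurring in an expression
    of [x], kills [x]. On the [m]-eigenvector [x] it is multiplication by the product of the
    [lam m - lam j], which is nonzero. *)
Lemma eigspan_eq0 (P : int -> Prop) m x :
  ~ P m -> phi x = lam m *: x -> eigspan P x -> x = 0.
Proof.
move=> nPm xm Px.
have phi0 : phi 0 = 0.
  by have := phiL (-1) 0 0; rewrite !scaleN1r oppr0 addr0 addNr.
have phiZ c v : phi (c *: v) = c *: phi v.
  by have := phiL c v 0; rewrite phi0 !addr0.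
have op_eig j v s : phi v = lam j *: v ->
    op s v = (\prod_(i <- s) (lam j - lam i)) *: v.
  move=> vj; elim: s => [|i s IH] /=; first by rewrite big_nil scale1r.
  rewrite IH big_cons phiZ vj !scalerA -scalerBl mulrBl.
  by rewrite [X in X - _]mulrC.
have opL s c u v : op s (c *: u + v) = c *: op s u + op s v.
  elim: s => //= i s ->; rewrite phiL scalerDr opprD addrACA scalerBr.
  by rewrite !scalerA [lam i * c]mulrC.
have [s sP s0] : exists2 s, forall j, j \in s -> P j & op s x = 0.
  elim: Px => [|c u v [j Pj uj] _ [s sP s0]].
    by exists [::].
  exists (j :: s) => [i|]; first by rewrite inE => /orP[/eqP->|/sP].
  rewrite opL (op_eig j) // big_cons subrr mul0r scale0r scaler0 add0r.
  by rewrite /= s0 phi0 scaler0 subr0.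
move/eqP: s0; rewrite (op_eig m) // scaler_eq0 => /orP[|/eqP//].
rewrite prodf_seq_eq0 => /hasP[j js]; rewrite /= subr_eq0 => /eqP/lamI mj.
by case: nPm; rewrite mj; exact: sP.
Qed.

End Eigen.

(** * Tensor products and filtrations *)

Section TensorMaps.
Variables (F : fieldType) (V W : lmodType F).

(** Pure tensors generate the tensor product already as an abelian group, scalars being absorbed
    into a factor. *)
Lemma tens_eq_additive (Z : zmodType) (f g : tens V W -> Z) :
  zmod_morphism f -> zmod_morphism g ->
  (forall v w, f (tpure v w) = g (tpure v w)) -> f =1 g.
Proof.
move=> fB gB fg.
have f0 : f 0 = 0 by have := fB 0 0; rewrite !subrr.
have g0 : g 0 = 0 by have := gB 0 0; rewrite !subrr.
elim/tens_ind => [|x y hx hy|//]; first by rewrite f0 g0.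
by rewrite fB gB hx hy.
Qed.

Lemma tlift_linear (Z : lmodType F) (phi : V -> W -> Z) :
  balanced phi -> (forall c v w, phi (c *: v) w = c *: phi v w) ->
  linear (tlift phi).
Proof.
move=> bal phiZ c x y; rewrite tliftD //; congr (_ + _).
elim/tens_ind: x => [|x z hx hz|v w].
- have t0 : tlift phi 0 = 0 by have := tliftB bal 0 0; rewrite !subrr.
  by rewrite scaler0 t0 scaler0.
- by rewrite scalerBr !(tliftB bal) hx hz scalerBr.
- by rewrite -tpureZl !tlift_pure.
Qed.

Lemma tpure_linl (w : W) : linear (fun v : V => tpure v w).
Proof. by move=> c x y; rewrite tpureDl tpureZl. Qed.

Lemma tpureZr c (v : V) (w : W) : tpure v (c *: w) = c *: tpure v w.
Proof. by rewrite -tpureZ tpureZl. Qed.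

Lemma tpure_linr (v : V) : linear (fun w : W => tpure v w).
Proof. by move=> c x y; rewrite tpureDr tpureZr. Qed.

Lemma tpure0l (w : W) : tpure (0 : V) w = 0.
Proof. by rewrite -(scale0r (0 : V)) tpureZl scale0r. Qed.

Lemma tpure0r (v : V) : tpure v (0 : W) = 0.
Proof. by rewrite -(scale0r (0 : W)) tpureZr scale0r. Qed.

End TensorMaps.

Section TensorMapMorph.
Variables (F : fieldType) (V W V' W' : lmodType F).
Variables (f : V -> V') (g : W -> W').
Hypotheses (fL : linear f) (gL : linear g).

Lemma linear_DZ (X Y : lmodType F) (h : X -> Y) : linear h ->
  {morph h : u v / u + v} * (forall c v, h (c *: v) = c *: h v).
Proof.
move=> hL.
have hD : {morph h : u v / u + v}.
  by move=> u v; rewrite -[u in LHS]scale1r hL scale1r.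
have h0 : h 0 = 0.
  by have /eqP := hD 0 0; rewrite addr0 -{1}[h 0]addr0 (inj_eq (addrI _)) => /eqP <-.
by split=> // c v; rewrite -[_ *: v]addr0 hL h0 addr0.
Qed.

Let bal : balanced (fun v w => tpure (f v) (g w)).
Proof.
have [fD fZ] := linear_DZ fL; have [gD gZ] := linear_DZ gL.
exact: (@tmap_balanced F V W V' W' idfun f g fD gD fZ gZ).
Qed.

Lemma tmap_pure v w : tmap f g (tpure v w) = tpure (f v) (g w).
Proof. exact: (tlift_pure bal). Qed.

Lemma tmap_linear : linear (tmap f g).
Proof.
apply: tlift_linear => // c v w.
by rewrite (linear_DZ fL).2 tpureZl.
Qed.

End TensorMapMorph.

(** * Filtered algebras and their completions *)

Section Filtration.
Variables (F : fieldType) (A : algType F).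
Implicit Types (H : nat -> A -> Prop) (s t u : nat -> A).

(** The members are left ideals. Right multiplication by [a] may lose degrees, but at most a number
    [p] depending on [a] alone, so it is continuous. *)
Record filtration H : Prop := Filtration {
  filt0 : forall N, H N 0;
  filt_comb : forall N c x y, H N x -> H N y -> H N (c *: x + y);
  filtS : forall N x, H N.+1 x -> H N x;
  filtMl : forall N a x, H N x -> H N (a * x);
  filtMr : forall a, exists p, forall N x, H (N + p)%N x -> H N (x * a)
}.

Variables (H : nat -> A -> Prop) (fH : filtration H).

Lemma filtD N x y : H N x -> H N y -> H N (x + y).
Proof. by rewrite -{2}[x]scale1r; exact: filt_comb. Qed.

Lemma filtN N x : H N x -> H N (- x).
Proof.
by move=> Hx; rewrite -scaleN1r -[_ *: _]addr0; apply: filt_comb => //; exact: filt0.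
Qed.

Lemma filt_le N M x : (N <= M)%N -> H M x -> H N x.
Proof.
move=> /subnKC <-; elim: (M - N)%N => [|m IH]; first by rewrite addn0.
by rewrite addnS => /(filtS fH).
Qed.

Lemma ceq_sym s t : ceq H s t -> ceq H t s.
Proof.
by move=> st N; have [n0 h] := st N; exists n0 => n /h /filtN; rewrite opprB.
Qed.

Lemma ceq_trans t s u : ceq H s t -> ceq H t u -> ceq H s u.
Proof.
move=> st tu N; have [n0 h] := st N; have [n1 h1] := tu N.
exists (maxn n0 n1) => n; rewrite geq_max => /andP[/h Hs /h1 Ht].
by rewrite -[s n](subrK (t n)) -addrA; exact: filtD.
Qed.

Lemma ceqD s t s' t' : ceq H s t -> ceq H s' t' ->
  ceq H (fun n => s n + s' n) (fun n => t n + t' n).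
Proof.
move=> st tu N; have [n0 h] := st N; have [n1 h1] := tu N.
exists (maxn n0 n1) => n; rewrite geq_max => /andP[/h Hs /h1 Ht].
by rewrite opprD addrACA; exact: filtD.
Qed.

Lemma ceqZ c s t : ceq H s t -> ceq H (fun n => c *: s n) (fun n => c *: t n).
Proof.
move=> st N; have [n0 h] := st N; exists n0 => n /h Hs.
by rewrite -scalerBr -[_ *: _]addr0; apply: filt_comb => //; exact: filt0.
Qed.

Lemma ceqMl u s t : ceq H s t ->
  ceq H (fun n => u n * s n) (fun n => u n * t n).
Proof.
move=> st N; have [n0 h] := st N; exists n0 => n /h Hs.
by rewrite -mulrBr; exact: filtMl.
Qed.

(** Write [u n] as a small term plus the fixed [u n0]. The small term is absorbed by the left ideal;
    the loss [p] caused by [u n0] is compensated by comparing [s] and [t] in degree [N + p]. *)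
Lemma ceqMr u s t : cauchy H u -> ceq H s t ->
  ceq H (fun n => s n * u n) (fun n => t n * u n).
Proof.
move=> cu st N; have [n0 h0] := cu N.
have [p hp] := filtMr fH (u n0); have [n1 h1] := st (N + p)%N.
exists (maxn n0 n1) => n; rewrite geq_max => /andP[n0n /h1 Hs].
rewrite -mulrBl -[u n](subrK (u n0)) mulrDr; apply: filtD; last exact: hp.
by apply: filtMl => //; exact: h0.
Qed.

Lemma cauchy_cst a : cauchy H (fun=> a).
Proof. by move=> N; exists 0%N => m n _ _; rewrite subrr; exact: filt0. Qed.

End Filtration.

Lemma ceq_sub (F : fieldType) (V : lmodType F) (H K : nat -> V -> Prop) s t :
  (forall N x, H N x -> K N x) -> ceq H s t -> ceq K s t.
Proof. by move=> HK st N; have [n0 h] := st N; exists n0 => n /h /HK. Qed.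

Lemma cauchy_sub (F : fieldType) (V : lmodType F) (H K : nat -> V -> Prop) s :
  (forall N x, H N x -> K N x) -> cauchy H s -> cauchy K s.
Proof.
move=> HK st N; have [n0 h] := st N.
by exists n0 => m n hm hn; apply: HK; exact: h.
Qed.

Section TensorFiltration.
Variables (F : fieldType) (A B : algType F).
Variables (H : nat -> A -> Prop) (K : nat -> B -> Prop).
Hypotheses (fH : filtration H) (fK : filtration K).

Definition tfilt (N : nat) : tens A B -> Prop :=
  lspan (fun x => exists a b, (H N a \/ K N b) /\ x = tpure a b).

(** For right multiplication, a pure tensor loses at most the larger of the losses of its two
    factors, and a difference at most the larger of the losses of its two terms. *)
Lemma tfilt_filtration : filtration tfilt.
Proof.
have fD N x y : tfilt N x -> tfilt N y -> tfilt N (x - y) by exact: lspanB.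
split=> [N|N c x y|N x|N a x|a].
- exact: lspan0.
- exact: lspan_comb.
- apply: lspan_sub => {}x [a [b [Hab ->]]]; apply: lspan_gen; exists a, b.
  by split=> //; case: Hab => [/(filtS fH)|/(filtS fK)]; [left|right].
- elim/tens_ind: a x => [|a b ha hb|c d] x Hx.
  + by rewrite mul0r; exact: lspan0.
  + by rewrite mulrBl; apply: lspanB; [exact: ha|exact: hb].
  + move: x Hx; apply: (lspan_map (mulL_linear _)) => x [a [b [Hab ->]]].
    apply: lspan_gen; exists (c * a), (d * b); rewrite -tmul_pure; split=> //.
    by case: Hab => [/(filtMl fH c)|/(filtMl fK d)]; [left|right].
- elim/tens_ind: a => [|x y [p hp] [r hr]|c d].
  + by exists 0%N => N x _; rewrite mulr0; exact: lspan0.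
  + exists (maxn p r) => N z Hz; rewrite mulrBr; apply: lspanB.
      apply: hp; move: Hz; apply: lspan_sub => _ [a [b [Hab ->]]].
      apply: lspan_gen; exists a, b; split=> //; move: Hab.
      by case=> [/(filt_le fH)|/(filt_le fK)] h; [left|right]; apply: h;
         rewrite leq_add2l leq_maxl.
    apply: hr; move: Hz; apply: lspan_sub => _ [a [b [Hab ->]]].
    apply: lspan_gen; exists a, b; split=> //; move: Hab.
    by case=> [/(filt_le fH)|/(filt_le fK)] h; [left|right]; apply: h;
       rewrite leq_add2l leq_maxr.
  + have [p hp] := filtMr fH c; have [s hs] := filtMr fK d.
    exists (maxn p s) => N; apply: (lspan_map (mulR_linear _)) => _ [a [b [Hab ->]]].
    apply: lspan_gen; exists (a * c), (b * d); rewrite -tmul_pure; split=> //.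
    case: Hab => [/(filt_le fH)|/(filt_le fK)] h; [left|right].
      by apply/hp/h; rewrite leq_add2l leq_maxl.
    by apply/hs/h; rewrite leq_add2l leq_maxr.
Qed.

End TensorFiltration.

Lemma ceq_mapl (F : fieldType) (A B : algType F) (H : nat -> A -> Prop)
    (K : nat -> B -> Prop) s t b : ceq H s t ->
  ceq (tfilt H K) (fun n => tpure (s n) b) (fun n => tpure (t n) b).
Proof.
move=> st N; have [n0 h] := st N; exists n0 => n /h Hs.
apply: lspan_gen; exists (s n - t n), b; split; first by left.
have -> : s n - t n = (-1) *: t n + s n by rewrite scaleN1r addrC.
by rewrite tpure_linl scaleN1r addrC.
Qed.

(** * The algebra U *)

Section Presentation.
Variables (k : fieldType) (q : k) (r : nat).
Local Notation U := (U q r).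
Local Notation FA := {malg k[{fmonom (qgen r)}]}.
Local Notation fgen := (fgen k).

Definition Ugen (g : qgen r) : U := Upi q (fgen g).

Lemma Upi_mul (x y : FA) : Upi q x * Upi q y = Upi q (x * y).
Proof. exact: UpiM. Qed.

Lemma Upi_scale c (x : FA) : c *: Upi q x = Upi q (c *: x).
Proof. exact: UpiZ. Qed.

Lemma Upi_add (x y : FA) : Upi q (x + y) = Upi q x + Upi q y.
Proof. exact: raddfD. Qed.

Lemma Upi_sub (x y : FA) : Upi q (x - y) = Upi q x - Upi q y.
Proof. exact: raddfB. Qed.

Lemma Upi_0 : Upi q 0 = 0 :> U.
Proof. exact: raddf0. Qed.

Lemma Upi_1 : Upi q 1 = 1 :> U.
Proof. by []. Qed.

Lemma Urel_eq (x y : FA) : Urel q x y -> Upi q x = Upi q y.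
Proof. by move=> h; apply/UpiP; exact: Uideal_rel. Qed.

(** The images of words span [U], and a word is built by adding letters on the left. *)
Lemma U_word_ind (P : U -> Prop) :
  (forall c x y, P x -> P y -> P (c *: x + y)) -> P 1 ->
  (forall g x, P x -> P (Ugen g * x)) -> forall x, P x.
Proof.
move=> Plin P1 Pg x.
have P0 : P 0 by have := Plin (-1) _ _ P1 P1; rewrite scaleN1r addNr.
have Pw (m : {fmonom (qgen r)}) : P (Upi q << m >>).
  case: m; elim=> [|g s IH].
    by have -> : FMonom [::] = mone :> {fmonom (qgen r)} by rewrite -fmoneE.
  have -> : << FMonom (g :: s) >> = fgen g * << FMonom s >> :> FA.
    rewrite /Defs.fgen -lock; apply/esym; rewrite -[LHS]/(fgmul _ _) fgmulUU mulr1.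
    by rewrite /mmul /= fmuE fmmulE.
  by rewrite -Upi_mul; exact: Pg.
rewrite -[x]UreprK; move: (Urepr x) => {}x.
rewrite [x]monalgE raddf_sum; elim: (enum_fset _) => [|m s IH].
  by rewrite big_nil.
rewrite big_cons; have -> : << x@_m *g m >> = x@_m *: << m >> :> FA.
  rewrite -mul_malgC; apply/esym; rewrite -[LHS]/(fgmul _ _) fgmulUU mulr1.
  by congr (<< _ *g _ >>); exact: mul1m.
by rewrite /= -Upi_scale; exact: Plin.
Qed.

Lemma U_gen_ind (P : U -> Prop) :
  (forall c x y, P x -> P y -> P (c *: x + y)) -> P 1 ->
  (forall x y, P x -> P y -> P (x * y)) -> (forall g, P (Ugen g)) ->
  forall x, P x.
Proof. by move=> Plin P1 PM Pg; apply: U_word_ind => // g x; exact: PM. Qed.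

(** * The universal property of the presentation *)

Section Lift.
Variables (A : algType k) (f : qgen r -> A).

Definition word_map (m : {fmonom (qgen r)}) : A := \prod_(g <- fmonom_val m) f g.

Fact word_mapM : mmorphism word_map.
Proof.
split=> [x y|]; rewrite /word_map.
  by rewrite /mmul /= fmmulE big_cat.
by rewrite /mone /= fmoneE big_nil.
Qed.

HB.instance Definition _ :=
  monalg.isMultiplicative.Build _ _ word_map word_mapM.

Definition FAlift (x : FA) : A := mmap (in_alg A) word_map x.

Fact FAlift_comm : forall (g : FA) m m',
  GRing.comm (in_alg A g@_m) (word_map m').
Proof. by move=> g m m'; rewrite /GRing.comm /= -scalerAr -scalerAl mulr1 mul1r. Qed.

Fact FAlift_zmod_morphism : zmod_morphism FAlift.
Proof. exact: mmapB. Qed.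

Fact FAlift_monoid_morphism : monoid_morphism FAlift.
Proof.
have [H _] := commr_mmap_is_multiplicative FAlift_comm.
by split; [exact: mmap1 | exact: H].
Qed.

HB.instance Definition _ :=
  GRing.isZmodMorphism.Build FA A FAlift FAlift_zmod_morphism.
HB.instance Definition _ :=
  GRing.isMonoidMorphism.Build FA A FAlift FAlift_monoid_morphism.

Lemma FAliftZ c x : FAlift (c *: x) = c *: FAlift x.
Proof. by rewrite /FAlift mmapZ /= -scalerAl mul1r. Qed.

Lemma FAlift_gen g : FAlift (fgen g) = f g.
Proof.
rewrite /FAlift /Defs.fgen -lock mmapU /= /word_map fmuE big_cons big_nil.
by rewrite scale1r mul1r mulr1.
Qed.

Hypothesis f_rel : forall x y, Urel q x y -> FAlift x = FAlift y.

Lemma FAlift_ideal x : Uideal q x -> FAlift x = 0.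
Proof.
elim=> [{}x y h||{}x y _ hx _ hy|a {}x _ hx|a {}x _ hx]; rewrite ?rmorph0 //.
- by rewrite rmorphB /= (f_rel h) subrr.
- by rewrite rmorphB /= hx hy subrr.
- by rewrite rmorphM /= hx mulr0.
- by rewrite rmorphM /= hx mul0r.
Qed.

(** Computed on a representative; [f_rel] makes the value independent of the choice. *)
Definition Ulift (x : U) : A := FAlift (Urepr x).

Lemma Ulift_pi x : Ulift (Upi q x) = FAlift x.
Proof.
apply/eqP; rewrite -subr_eq0 -rmorphB /=; apply/eqP/FAlift_ideal/UpiP.
exact: UreprK.
Qed.

Lemma Ulift_linear : linear Ulift.
Proof.
move=> c x y; rewrite -[x]UreprK -[y]UreprK Upi_scale -Upi_add !Ulift_pi.
by rewrite rmorphD /= FAliftZ.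
Qed.

Lemma UliftM x y : Ulift (x * y) = Ulift x * Ulift y.
Proof. by rewrite -[x]UreprK -[y]UreprK Upi_mul !Ulift_pi rmorphM. Qed.

Lemma Ulift1 : Ulift 1 = 1.
Proof. by rewrite -Upi_1 Ulift_pi rmorph1. Qed.

Lemma Ulift_gen g : Ulift (Ugen g) = f g.
Proof. by rewrite /Ugen Ulift_pi FAlift_gen. Qed.

End Lift.

(** * The defining relations, read in U *)

Lemma UKKV i : UK q i * UKV q i = 1 :> U.
Proof. by rewrite Upi_mul -Upi_1; apply: Urel_eq; exact: Urel_KKV. Qed.

Lemma UKVK i : UKV q i * UK q i = 1 :> U.
Proof. by rewrite Upi_mul -Upi_1; apply: Urel_eq; exact: Urel_KVK. Qed.

Lemma UKC i j : UK q i * UK q j = UK q j * UK q i :> U.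
Proof. by rewrite !Upi_mul; apply: Urel_eq; exact: Urel_KK. Qed.

Lemma UKE i j : UK q i * UE q j * UKV q i =
  q ^ Defs.form (alpha i) (alpha j) *: UE q j :> U.
Proof. by rewrite !Upi_mul Upi_scale; apply: Urel_eq; exact: Urel_KE. Qed.

Lemma UKF i j : UK q i * UF q j * UKV q i =
  q ^ (- Defs.form (alpha i) (alpha j)) *: UF q j :> U.
Proof. by rewrite !Upi_mul Upi_scale; apply: Urel_eq; exact: Urel_KF. Qed.

Lemma UEF i j : UE q i * UF q j - UF q j * UE q i =
  (if i == j then (q - q^-1)^-1 *: (UK q i - UKV q i) else 0) :> U.
Proof.
rewrite !Upi_mul -Upi_sub (Urel_eq (Urel_EF q i j)).
by case: ifP => _; rewrite ?Upi_0 // -Upi_scale Upi_sub.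
Qed.

Lemma UEE i j : Defs.form (alpha i) (alpha j) = 0 ->
  UE q i * UE q j = UE q j * UE q i :> U.
Proof. by move=> h; rewrite !Upi_mul; apply: Urel_eq; exact: Urel_EE. Qed.

Lemma UFF i j : Defs.form (alpha i) (alpha j) = 0 ->
  UF q i * UF q j = UF q j * UF q i :> U.
Proof. by move=> h; rewrite !Upi_mul; apply: Urel_eq; exact: Urel_FF. Qed.

Lemma UserreE i j : Defs.form (alpha i) (alpha j) = -1 ->
  UE q i * UE q i * UE q j - (q + q^-1) *: (UE q i * UE q j * UE q i)
    + UE q j * UE q i * UE q i = 0 :> U.
Proof.
move=> h; rewrite !Upi_mul Upi_scale -Upi_sub -Upi_add.
by rewrite (Urel_eq (Urel_serreE q h)) Upi_0.
Qed.

Lemma UserreF i j : Defs.form (alpha i) (alpha j) = -1 ->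
  UF q i * UF q i * UF q j - (q + q^-1) *: (UF q i * UF q j * UF q i)
    + UF q j * UF q i * UF q i = 0 :> U.
Proof.
move=> h; rewrite !Upi_mul Upi_scale -Upi_sub -Upi_add.
by rewrite (Urel_eq (Urel_serreF q h)) Upi_0.
Qed.

End Presentation.

(** * The Chevalley involution *)

Section Chevalley.
Variables (k : fieldType) (q : k) (r : nat).
Hypothesis q0 : q != 0.
Local Notation U := (U q r).

Definition chev_gen (g : qgen r) : U :=
  match g with
  | GenE i => UF q i | GenF i => UE q i | GenK i => UKV q i | GenKV i => UK q i
  end.

Lemma conj_inv (A : algType k) (g g' x : A) (c : k) : c != 0 ->
  g' * g = 1 -> g * x * g' = c *: x -> g' * x * g = c^-1 *: x.
Proof.
move=> c0 gg h; rewrite -[LHS]scale1r -(mulVf c0) -scalerA; congr (_ *: _).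
by rewrite scalerAl scalerAr -h !mulrA gg mul1r -mulrA gg mulr1.
Qed.

(** Both sides are inverse to [UK q i * UK q j]. *)
Lemma UKVC i j : UKV q i * UKV q j = UKV q j * UKV q i :> U.
Proof.
have e1 : UKV q i * UKV q j * (UK q i * UK q j) = 1 :> U.
  by rewrite UKC mulrA -(mulrA (UKV q i)) UKVK mulr1 UKVK.
have e2 : UK q i * UK q j * (UKV q j * UKV q i) = 1 :> U.
  by rewrite mulrA -(mulrA (UK q i)) UKKV mulr1 UKKV.
by rewrite -[LHS]mulr1 -e2 mulrA e1 mul1r.
Qed.

(** The relations among the E and those among the F are exchanged. Conjugation relations are
    inverted by [conj_inv], and in the commutator relation both sides change sign. *)
Fact chev_rel x y : Urel q x y -> FAlift chev_gen x = FAlift chev_gen y.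
Proof.
pose f := FAlift chev_gen.
have fM a b : f (a * b) = f a * f b by exact: rmorphM.
have fB a b : f (a - b) = f a - f b by exact: rmorphB.
have fD a b : f (a + b) = f a + f b by exact: rmorphD.
have f1 : f 1 = 1 by exact: rmorph1.
have f0 : f 0 = 0 by exact: rmorph0.
have fZ c a : f (c *: a) = c *: f a by exact: FAliftZ.
have fg g : f (fgen k g) = chev_gen g by exact: FAlift_gen.
have fgg g h : f (fgen k g * fgen k h) = chev_gen g * chev_gen h.
  by apply: etrans (fM _ _) _; rewrite !fg.
have fserre c a b : f (a * a * b - c *: (a * b * a) + b * a * a) =
    f a * f a * f b - c *: (f a * f b * f a) + f b * f a * f a.
  have f3 x1 x2 x3 : f (x1 * x2 * x3) = f x1 * f x2 * f x3.
    by apply: etrans (fM _ _) _; congr (_ * _); exact: fM.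
  apply: etrans (fD _ _) _; congr (_ + _); last exact: f3.
  apply: etrans (fB _ _) _; congr (_ - _); first exact: f3.
  by apply: etrans (fZ _ _) _; congr (_ *: _); exact: f3.
rewrite -/f; clearbody f.
case=> [i|i|i j|i j|i j|i j|i j h|i j h|i j h|i j h];
  move: (fgen k) fg fgg => e fg fgg.
- by rewrite fM !fg f1; exact: UKVK.
- by rewrite fM !fg f1; exact: UKKV.
- by apply: etrans (fgg _ _) (etrans _ (esym (fgg _ _))); exact: UKVC _ _.
- rewrite !fM fZ !fg /= (conj_inv _ (UKVK _ _) (UKF _ _ _)) ?expfz_neq0 //.
  by rewrite invr_expz opprK.
- rewrite !fM fZ !fg /= (conj_inv _ (UKVK _ _) (UKE _ _ _)) ?expfz_neq0 //.
  by rewrite invr_expz.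
- rewrite fB; apply: etrans (congr2 (fun a b => a - b) (fgg _ _) (fgg _ _)) _.
  have := UEF q j i; rewrite -opprB => /(congr1 -%R); rewrite opprK => ->.
  rewrite eq_sym; case: eqP => [->|_]; last by rewrite f0 oppr0.
  by rewrite fZ fB !fg -scalerN opprB.
- by apply: etrans (fgg _ _) (etrans _ (esym (fgg _ _))); exact: UFF h.
- by apply: etrans (fgg _ _) (etrans _ (esym (fgg _ _))); exact: UEE h.
- apply: etrans (fserre _ _ _) (etrans _ (esym f0)).
  by rewrite !fg; exact: UserreF.
- apply: etrans (fserre _ _ _) (etrans _ (esym f0)).
  by rewrite !fg; exact: UserreE.
Qed.

Definition chevalley : U -> U := Ulift chev_gen.

Lemma chevalley_linear : linear chevalley.
Proof. exact: Ulift_linear chev_rel. Qed.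

Lemma chevalleyM x y : chevalley (x * y) = chevalley x * chevalley y.
Proof. exact: UliftM chev_rel x y. Qed.

Lemma chevalley1 : chevalley 1 = 1.
Proof. exact: Ulift1 chev_rel. Qed.

Lemma chevalley_gen g : chevalley (Ugen q g) = chev_gen g.
Proof. exact: Ulift_gen chev_rel g. Qed.

End Chevalley.

(** * The height grading *)

Section RootForm.
Variable r : nat.
Local Notation n := r.*2.+1.
Implicit Types (u v : 'rV[int]_(n.+1)) (i j : 'I_n).

Lemma formBl u u' v : Defs.form (u - u') v = Defs.form u v - Defs.form u' v.
Proof.
rewrite /Defs.form -sumrB; apply: eq_bigr => t _.
by rewrite !mxE mulrBl.
Qed.

Lemma form_delta a v : Defs.form (delta_mx 0 a) v = v 0 a.
Proof.
rewrite /Defs.form (bigD1 a) //= mxE !eqxx mul1r big1 ?addr0 // => t ta.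
by rewrite mxE (negPf ta) andbF mul0r.
Qed.

Lemma form_alphaE i j :
  Defs.form (alpha i) (alpha j) =
  (i == j)%:R *+ 2 - (i == j.+1 :> nat)%:R - (i.+1 == j :> nat)%:R.
Proof.
have inordE a b : (a <= n)%N -> (b <= n)%N ->
    (inord a == inord b :> 'I_n.+1) = (a == b).
  by move=> ha hb; rewrite -val_eqE /= !inordK.
rewrite /alpha formBl !form_delta !mxE eqxx /= !inordE ?(ltnW (ltn_ord _)) //.
by rewrite eqSS val_eqE opprB addrCA addrA mulr2n !addrA addrAC.
Qed.

Lemma form_wt i (mu : NPi r) :
  Defs.form (alpha i) (wt mu) = \sum_j Defs.form (alpha i) (alpha j) *+ mu j.
Proof.
rewrite /Defs.form /wt.
transitivity (\sum_t \sum_j (alpha i 0 t * alpha j 0 t) *+ mu j).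
  apply: eq_bigr => t _; rewrite summxE mulr_sumr; apply: eq_bigr => j _.
  by rewrite mulmxnE mulrnAr.
by rewrite exchange_big; apply: eq_bigr => j _; rewrite sumrMnl.
Qed.

(* 2 rho = sum_i (i + 1) (n - i) alpha_i, so that (2 rho, alpha_j) = 2. *)
Definition two_rho : seq 'I_n :=
  flatten [seq nseq (i.+1 * (n - i)) i | i <- enum 'I_n].

Lemma sum_two_rho (f : 'I_n -> int) :
  \sum_(i <- two_rho) f i = \sum_i f i *+ (i.+1 * (n - i)).
Proof.
rewrite /two_rho big_flatten /= big_map -big_enum /=; apply: eq_bigr => i _.
by rewrite big_nseq -Monoid.iteropE.
Qed.

(** The coefficients c(i) = (i + 1)(n - i) satisfy 2 c(j) - c(j + 1) - c(j - 1) = 2, and c vanishes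
    at -1 and at n, so the missing neighbours at both ends of the diagram make no difference. *)
Lemma two_rho_alpha j :
  \sum_(i <- two_rho) Defs.form (alpha i) (alpha j) = 2.
Proof.
pose c (i : nat) : int := (i.+1 * (n - i))%N%:Z.
have pick m : \sum_(i < n) c i *+ (i == m :> nat) = if (m < n)%N then c m else 0.
  case: ltnP => [mn|nm]; last first.
    by rewrite big1 // => i _; rewrite ltn_eqF // (leq_trans (ltn_ord i)).
  rewrite (bigD1 (Ordinal mn)) //= eqxx big1 ?addr0 // => i /negPf.
  by rewrite -val_eqE /= => ->.
have picks : \sum_(i < n) c i *+ (i.+1 == j :> nat) = (j * (n - j).+1)%N%:Z.
  case: (nat_of_ord j) (ltn_ord j) => [|m] mn.
    by rewrite mul0n big1.
  under eq_bigr do rewrite eqSS.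
  by rewrite pick (ltnW mn) /c subnS prednK // subn_gt0 ltnW.
rewrite sum_two_rho (eq_bigr (fun i : 'I_n => c i *+ (i == j :> nat) *+ 2
   - c i *+ (i == j.+1 :> nat) - c i *+ (i.+1 == j :> nat))); last first.
  move=> i _; rewrite form_alphaE /c -[i == j]val_eqE /=.
  move: (i.+1 * _)%N (i == j :> nat) (i == j.+1 :> nat) (i.+1 == j :> nat).
  move=> m b1 b2 b3; rewrite -[m%:Z]natz !mulrnBl -!mulrnA.
  by congr (_ *+ _ - _ *+ _ - _ *+ _); rewrite mulnC ?mulnA // -mulnA mulnC.
rewrite !sumrB sumrMnl !pick picks ltn_ord.
have [m nE] : exists m, n = (j + m.+1)%N.
  by exists (n - j.+1)%N; rewrite addnS -addSn subnKC.
rewrite /c; move: {pick picks c} (nat_of_ord j) nE => l; move: n => N ->.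
have -> : (l + m.+1 - l)%N = m.+1 by lia.
have -> : (l + m.+1 - l.+1)%N = m by lia.
by case: ltnP => h; nia.
Qed.

End RootForm.

(** * Degrees for conjugation, and components of lowest degree *)

Section AdEigen.
Variables (k : fieldType) (q : k) (A : algType k).
Hypothesis q0 : q != 0.

(** Homogeneity of degree [d] for conjugation by [g], with [g'] in the role of the inverse of
    [g]. *)
Definition adeig (g g' : A) (d : int) (x : A) : Prop := g * x * g' = q ^ d *: x.

Lemma adeig_comb g g' d c x y :
  adeig g g' d x -> adeig g g' d y -> adeig g g' d (c *: x + y).
Proof.
rewrite /adeig mulrDr mulrDl -scalerAr -scalerAl => -> ->.
by rewrite scalerDr !scalerA mulrC.
Qed.

Lemma adeigM g g' d e x y : g' * g = 1 ->
  adeig g g' d x -> adeig g g' e y -> adeig g g' (d + e) (x * y).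
Proof.
move=> gg hx hy; rewrite /adeig.
have -> : g * (x * y) * g' = (g * x * g') * (g * y * g').
  by rewrite !mulrA -(mulrA (g * x) g' g) gg mulr1.
by rewrite hx hy -scalerAr -scalerAl scalerA -expfzDr // addrC.
Qed.

Lemma adeig1 g g' : g * g' = 1 -> adeig g g' 0 1.
Proof. by rewrite /adeig mulr1 expr0z scale1r. Qed.

Lemma adeig_conj g g' h h' d e x :
  adeig g g' d x -> adeig h h' e x -> adeig (g * h) (h' * g') (d + e) x.
Proof.
rewrite /adeig => hg hh; rewrite !mulrA -(mulrA g h) -(mulrA g) hh.
by rewrite -scalerAr -scalerAl hg scalerA -expfzDr // addrC.
Qed.

(** [x0] is the component of [x] in degree [m], all others being higher. It may be zero, which makes
    the relation stable under linear combinations. *)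
Definition lowest g g' (m : int) (x x0 : A) : Prop :=
  adeig g g' m x0 /\
  lspan (fun y => exists2 j, m < j & adeig g g' j y) (x - x0).

Section Lowest.
Variables (g g' : A).
Hypothesis g'g : g' * g = 1.
Local Notation low := (lowest g g').

Lemma lowest_hom m x : adeig g g' m x -> low m x x.
Proof. by move=> hx; split=> //; rewrite subrr; exact: lspan0. Qed.

Lemma lowest_comb m c x y x0 y0 :
  low m x x0 -> low m y y0 -> low m (c *: x + y) (c *: x0 + y0).
Proof.
move=> [ex hx] [ey hy]; split; first exact: adeig_comb.
by rewrite opprD addrACA -scalerBr; exact: lspan_comb.
Qed.

Lemma lowest_add m x x0 y : low m x x0 ->
  lspan (fun y => exists2 j, m < j & adeig g g' j y) y -> low m (x + y) x0.
Proof. by move=> [ex hx] hy; split=> //; rewrite addrAC; exact: lspanD. Qed.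

(** The difference [x * y - x0 * y0] splits into three products, each with at least one factor of
    degree above its minimum. *)
Lemma lowestM m n x y x0 y0 :
  low m x x0 -> low n y y0 -> low (m + n) (x * y) (x0 * y0).
Proof.
move=> [ex hx] [ey hy]; split; first exact: adeigM.
have -> : x * y - x0 * y0 = x0 * (y - y0) + (x - x0) * y0 + (x - x0) * (y - y0).
  by rewrite -addrA -mulrDr [y0 + _]addrC subrK mulrBr mulrBl addrC subrKA.
apply: lspanD; first apply: lspanD.
- move: hy; apply: (lspan_map (mulL_linear _)) => u [j mj hu]; apply: lspan_gen.
  by exists (m + j); [rewrite ltrD2l | exact: adeigM].
- move: hx; apply: (lspan_map (mulR_linear _)) => u [j mj hu]; apply: lspan_gen.
  by exists (j + n); [rewrite ltrD2r | exact: adeigM].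
- move: hx; apply: (lspan_map (mulR_linear _)) => u [j mj hu].
  move: hy; apply: (lspan_map (mulL_linear _)) => v [l nl hv]; apply: lspan_gen.
  by exists (j + l); [exact: ltrD | exact: adeigM].
Qed.

Lemma lowest_gt0 m n x x0 : m < n -> low n x x0 ->
  lspan (fun y => exists2 j, m < j & adeig g g' j y) x.
Proof.
move=> mn [ex hx]; rewrite -[x](subrK x0) addrC; apply: lspanD.
  by apply: lspan_gen; exists n.
move: hx; apply: lspan_sub => y [j nj hy]; apply: lspan_gen.
by exists j => //; exact: lt_trans nj.
Qed.

Lemma lowest_eq0 m x : injective (fun d : int => q ^ d) -> adeig g g' m x ->
  lspan (fun y => exists2 j, m < j & adeig g g' j y) x -> x = 0.
Proof.
move=> qI ex; apply: (@eigspan_eq0 _ _ (fun y => g * y * g') _ _ qI _ m) => //.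
  by move=> c u v; rewrite mulrDr mulrDl -scalerAr -scalerAl.
by rewrite ltxx.
Qed.

End Lowest.
End AdEigen.

Section Word.
Variables (R : pzRingType) (I : Type) (f : I -> R).
Implicit Types (i : I) (s t : seq I).

Definition word s : R := \prod_(i <- s) f i.

Lemma word_nil : word [::] = 1.
Proof. exact: big_nil. Qed.

Lemma word_cat s t : word (s ++ t) = word s * word t.
Proof. exact: big_cat. Qed.

Lemma word_cons i s : word (i :: s) = f i * word s.
Proof. exact: big_cons. Qed.

Lemma word1 i : word [:: i] = f i.
Proof. exact: big_seq1. Qed.

Lemma word_rcons s i : word (rcons s i) = word s * f i.
Proof. by rewrite -cats1 word_cat word1. Qed.

End Word.

(** * Height in U, and the left ideals F_N *)

Section Words.
Variables (k : fieldType) (q : k) (r : nat).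
Hypotheses (q0 : q != 0) (qI : injective (fun d : int => q ^ d)).
Local Notation U := (U q r).
Local Notation Idx := 'I_(r.*2.+1).
Local Notation E i := (UE q i).
Local Notation F i := (UF q i).
Local Notation K i := (UK q i).
Local Notation KV i := (UKV q i).
Local Notation Fword := (word (@UF _ q r)).
Implicit Types (i j : Idx) (s : seq Idx) (x y : U).

Definition Kprod s : U := \prod_(i <- s) K i.
(** In reversed order, so that the factors of [Kprod s * KVprod s] cancel from the inside. *)
Definition KVprod s : U := \prod_(i <- rev s) KV i.

Lemma KprodV s : Kprod s * KVprod s = 1.
Proof.
elim: s => [|i s IH]; rewrite /Kprod /KVprod.
  by rewrite !big_nil mulr1.
rewrite rev_cons -cats1 big_cons big_cat big_seq1 /=.
by rewrite mulrA -(mulrA (K i)) [X in _ * X * _]IH mulr1 UKKV.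
Qed.

Lemma KVprodK s : KVprod s * Kprod s = 1.
Proof.
elim: s => [|i s IH]; rewrite /Kprod /KVprod.
  by rewrite !big_nil mulr1.
rewrite rev_cons -cats1 big_cons big_cat big_seq1 /=.
by rewrite mulrA -(mulrA _ (KV i)) UKVK mulr1.
Qed.

Lemma Kprod_adeig s (f : Idx -> int) x :
  (forall i, adeig q (K i) (KV i) (f i) x) ->
  adeig q (Kprod s) (KVprod s) (\sum_(i <- s) f i) x.
Proof.
move=> hf; elim: s => [|i s IH].
  by rewrite /Kprod /KVprod /adeig !big_nil mul1r mulr1 expr0z scale1r.
rewrite /Kprod /KVprod rev_cons -cats1 !big_cons big_cat big_seq1 /=.
exact: adeig_conj.
Qed.

(* Conjugation by [K_{2 rho}] is the height grading. *)
Definition Krho : U := Kprod (two_rho r).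
Definition KrhoV : U := KVprod (two_rho r).

Lemma KrhoE i : adeig q Krho KrhoV 2 (E i).
Proof. by rewrite -(two_rho_alpha i); apply: Kprod_adeig => j; exact: UKE. Qed.

Lemma KrhoF i : adeig q Krho KrhoV (- 2) (F i).
Proof.
rewrite -(two_rho_alpha i) -sumrN; apply: Kprod_adeig => j; exact: UKF.
Qed.

Lemma KKV_comm i j : K i * KV j = KV j * K i.
Proof.
by rewrite -[LHS]mul1r -(UKVK q j) -mulrA (mulrA (K j)) (UKC q j) -mulrA UKKV mulr1.
Qed.

Lemma KrhoK i : adeig q Krho KrhoV 0 (K i).
Proof.
have := @Kprod_adeig (two_rho r) (fun=> 0); rewrite big1 //; apply=> j.
by rewrite /adeig UKC -mulrA UKKV mulr1 expr0z scale1r.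
Qed.

Lemma KrhoKV i : adeig q Krho KrhoV 0 (KV i).
Proof.
have := @Kprod_adeig (two_rho r) (fun=> 0); rewrite big1 //; apply=> j.
by rewrite /adeig KKV_comm -mulrA UKKV mulr1 expr0z scale1r.
Qed.

(** By [two_rho_alpha], pairing 2 rho with a weight gives twice its height. *)
Lemma Krho_wt (mu : NPi r) x : Uminus_wt mu x ->
  adeig q Krho KrhoV (- (ht mu).*2%:Z) x.
Proof.
move=> [_ hx].
have -> : - (ht mu).*2%:Z =
    \sum_(i <- two_rho r) - Defs.form (alpha i) (wt mu).
  rewrite sumrN; congr (- _); under eq_bigr do rewrite form_wt.
  rewrite exchange_big /=; under eq_bigr do rewrite sumrMnl two_rho_alpha.
  by rewrite -mul2n /ht big_distrr /= -natz natr_sum; apply: eq_bigr => i _; lia.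
exact: Kprod_adeig.
Qed.

Lemma Fword_adeig s : adeig q Krho KrhoV (- (size s).*2%:Z) (Fword s).
Proof.
elim: s => [|i s IH].
  by rewrite word_nil oppr0; apply: adeig1; exact: KprodV.
rewrite word_cons (_ : - _ = -2 + - (size s).*2%:Z); last by rewrite /=; lia.
by apply: adeigM => //; [exact: KVprodK | exact: KrhoF].
Qed.

Lemma Uminus_span x : Uminus x -> lspan (fun y => exists s, y = Fword s) x.
Proof.
elim=> [_ [i ->]||c y z _ hy _ hz|y z _ hy _ hz].
- by apply: lspan_gen; exists [:: i]; rewrite word1.
- by apply: lspan_gen; exists [::]; rewrite word_nil.
- exact: lspan_comb.
move: hy; apply: (lspan_map (mulR_linear _)) => _ [s ->].
move: hz; apply: (lspan_map (mulL_linear _)) => _ [t ->]; apply: lspan_gen.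
by exists (s ++ t); rewrite word_cat.
Qed.

(** Expand [x] in words and let [z] collect those of length other than [ht mu]. Then [z] is
    homogeneous of degree -2 [ht mu] for K_{2 rho}, and at the same time a combination of elements
    of other degrees, hence zero. *)
Lemma Uminus_wt_span (mu : NPi r) x : Uminus_wt mu x ->
  lspan (fun y => exists2 s, size s = ht mu & y = Fword s) x.
Proof.
move=> hx; have [/Uminus_span hs _] := hx.
have [|y [z [hy hz xE]]] := lspan_split
  (T1 := fun y => exists2 s, size s = ht mu & y = Fword s)
  (T2 := fun y => exists2 s, size s <> ht mu & y = Fword s) _ hs.
  move=> _ [s ->]; have [h|/eqP h] := eqVneq (size s) (ht mu); [left|right];
    by exists s.
suff z0 : z = 0 by rewrite xE z0 addr0.
apply: (@eigspan_eq0 k U (fun y => Krho * y * KrhoV) _ _ qI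
  (fun j : int => j <> - (ht mu).*2%:Z) (- (ht mu).*2%:Z)).
- by move=> c u v; rewrite mulrDr mulrDl -scalerAr -scalerAl.
- by [].
- have -> : z = (-1) *: y + x by rewrite xE scaleN1r addKr.
  apply: adeig_comb (Krho_wt hx).
  elim: hy => [|c u v [s sE ->] _ IH].
    by rewrite /adeig mulr0 mul0r scaler0.
  by apply: adeig_comb IH; rewrite -sE; exact: Fword_adeig.
- move: hz; apply: lspan_sub => _ [s sE ->]; apply: lspan_gen.
  exists (- (size s).*2%:Z); last exact: Fword_adeig.
  by move=> /oppr_inj; lia.
Qed.

(** This is F_N, a left ideal by construction; it contains [Ufilt N] by [Ufilt_Ffilt]. *)
Definition Ffilt (N : nat) : U -> Prop :=
  lspan (fun x => exists y s, size s = N /\ x = y * Fword s).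

Lemma FfiltMl N x y : Ffilt N y -> Ffilt N (x * y).
Proof.
apply: (lspan_map (mulL_linear _)) => _ [z [s [sN ->]]]; apply: lspan_gen.
by exists (x * z), s; rewrite mulrA.
Qed.

Lemma FfiltW N x : Ffilt N.+1 x -> Ffilt N x.
Proof.
apply: lspan_sub => _ [y [s [sN ->]]]; case: s sN => //= i s [sN].
by apply: lspan_gen; exists (y * F i), s; rewrite word_cons mulrA.
Qed.

Lemma FfiltMF N x i : Ffilt N x -> Ffilt N.+1 (x * F i).
Proof.
apply: (lspan_map (mulR_linear _)) => _ [y [s [sN ->]]]; apply: lspan_gen.
by exists y, (rcons s i); rewrite size_rcons sN word_rcons mulrA.
Qed.

Lemma FK i j : exists c, F j * K i = c *: (K i * F j).
Proof.
have h := conj_inv (expfz_neq0 _ q0) (UKVK q i) (UKF q i j).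
eexists; rewrite -[LHS]mul1r -(UKKV q i) -!mulrA (mulrA (KV i)) h -scalerAr.
reflexivity.
Qed.

Lemma FKV i j : exists c, F j * KV i = c *: (KV i * F j).
Proof.
eexists; rewrite -[LHS]mul1r -(UKVK q i) -!mulrA (mulrA (K i)) UKF -scalerAr.
reflexivity.
Qed.

Lemma Fword_comm g s : (forall j, exists c, F j * g = c *: (g * F j)) ->
  exists c, Fword s * g = c *: (g * Fword s).
Proof.
move=> h; elim: s => [|i s [c IH]].
  by exists 1; rewrite word_nil mulr1 mul1r scale1r.
have [d hd] := h i; exists (c * d).
rewrite word_cons -mulrA IH -scalerAr (mulrA (F i)) hd -scalerAl scalerA.
by rewrite mulrA.
Qed.

Lemma FfiltMK N x g : (forall j, exists c, F j * g = c *: (g * F j)) ->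
  Ffilt N x -> Ffilt N (x * g).
Proof.
move=> h; apply: (lspan_map (mulR_linear _)) => _ [y [s [sN ->]]].
have [c hc] := Fword_comm s h; rewrite -mulrA hc -scalerAr.
by apply: lspanZ; apply: lspan_gen; exists (y * g), s; rewrite mulrA.
Qed.

(** Moving [E i] to the left through a word creates commutators; each replaces one letter F by a
    combination of K's, which pass through the rest up to scalars. So at most one letter is lost. *)
Lemma FfiltME N x i : Ffilt N.+1 x -> Ffilt N (x * E i).
Proof.
apply: (lspan_map (mulR_linear _)) => _ [y [s [sN ->]]]; rewrite -mulrA.
apply: FfiltMl; elim/last_ind: s N sN => [//|s j IH] N.
rewrite size_rcons word_rcons => -[sN]; rewrite -mulrA.
have Ft t M : size t = M -> Ffilt M (Fword t).
  by move=> tM; apply: lspan_gen; exists 1, t; rewrite mul1r.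
have -> : F j * E i = E i * F j - (E i * F j - F j * E i) by rewrite subKr.
rewrite mulrBr mulrA; apply: lspanB.
  (* [Ffilt 0] is all of U, so the induction hypothesis matters only for a nonempty [s]. *)
  case: N s IH sN => [|N] s IH sN.
    by apply: lspan_gen; exists (Fword s * E i * F j), [::]; rewrite word_nil mulr1.
  by apply/FfiltMF/IH.
rewrite UEF; case: eqP => _; last by rewrite mulr0; exact: lspan0.
rewrite -scalerAr mulrBr; apply/lspanZ/lspanB.
  by apply: FfiltMK (FK i) (Ft _ _ sN).
by apply: FfiltMK (FKV i) (Ft _ _ sN).
Qed.

Lemma Ffilt_filtration : filtration Ffilt.
Proof.
have le M N x : (N <= M)%N -> Ffilt M x -> Ffilt N x.
  move=> /subnKC <-; elim: (M - N)%N => [|m IH]; first by rewrite addn0.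
  by rewrite addnS => /FfiltW.
split=> [N|N c x y|N x|N a x|a].
- exact: lspan0.
- exact: lspan_comb.
- exact: FfiltW.
- exact: FfiltMl.
elim/U_gen_ind: a => [c x y [p hp] [p' hp']||x y [p hp] [p' hp']|g].
- exists (maxn p p') => N z hz; rewrite mulrDr -scalerAr; apply: lspan_comb.
    by apply: hp; apply: le hz; rewrite leq_add2l leq_maxl.
  by apply: hp'; apply: le hz; rewrite leq_add2l leq_maxr.
- by exists 0%N => N x; rewrite addn0 mulr1.
- exists (p' + p)%N => N z hz; rewrite mulrA; apply/hp'/hp.
  by rewrite -addnA.
(* A loss of one degree covers every generator; it occurs for E, and the other cases are weakened to
   match. *)
exists 1%N => N x; rewrite addn1; case: g => i h.
- exact: FfiltME.
- exact/FfiltW/FfiltW/FfiltMF.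
- exact/FfiltW/FfiltMK/h/FK.
- exact/FfiltW/FfiltMK/h/FKV.
Qed.

Lemma Uminus_wt_Ffilt N (mu : NPi r) x :
  Uminus_wt mu x -> (N <= ht mu)%N -> Ffilt N x.
Proof.
move=> /Uminus_wt_span hx Nmu; apply: (filt_le Ffilt_filtration Nmu).
move: hx; apply: lspan_sub => _ [s sE ->]; apply: lspan_gen.
by exists 1, s; rewrite mul1r.
Qed.

Lemma Ufilt_Ffilt N x : Ufilt N x -> Ffilt N x.
Proof.
apply: lspan_sub => _ [a [h [b [mu [_ _ hb Nmu ->]]]]].
by apply: FfiltMl; exact: Uminus_wt_Ffilt hb Nmu.
Qed.

End Words.

(** * Separation of the filtration *)

Lemma tpureM (F : fieldType) (A B : algType F) (a a' : A) (b b' : B) :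
  tpure a b * tpure a' b' = tpure (a * a') (b * b').
Proof. exact: tmul_pure. Qed.

Lemma tmapM (F : fieldType) (A B A' B' : algType F) (f : A -> A') (g : B -> B') :
  linear f -> linear g ->
  {morph f : x y / x * y} -> {morph g : x y / x * y} ->
  {morph tmap f g : x y / x * y}.
Proof.
move=> fL gL fM gM x y.
have [tD tZ] := linear_DZ (tmap_linear fL gL).
have tB u v : tmap f g (u - v) = tmap f g u - tmap f g v.
  by rewrite -scaleN1r tD tZ scaleN1r.
have t0 : tmap f g 0 = 0 by have := tB 0 0; rewrite !subrr.
elim/tens_ind: x => [|x x' hx hx'|a b]; first by rewrite mul0r t0 mul0r.
  by rewrite mulrBl !tB hx hx' mulrBl.
elim/tens_ind: y => [|y y' hy hy'|c d]; first by rewrite mulr0 t0 mulr0.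
  by rewrite mulrBr !tB hy hy' mulrBr.
by rewrite !tmap_pure // !tpureM tmap_pure // fM gM.
Qed.

Lemma mul_inv_uniq (R : pzRingType) (a b c : R) : a * b = 1 -> b * c = 1 -> a = c.
Proof. by move=> ab bc; rewrite -[a]mulr1 -bc mulrA ab mul1r. Qed.

Lemma adeig_pure (k : fieldType) (q : k) (A B : algType k) (g g' x : A) (h h' y : B)
    (d e : int) : q != 0 -> adeig q g g' d x -> adeig q h h' e y ->
  adeig q (tpure g h) (tpure g' h') (d + e) (tpure x y).
Proof.
move=> q0; rewrite /adeig !tpureM => -> ->.
by rewrite tpureZl tpureZr scalerA -expfzDr.
Qed.

(** * Lowest components of the iterated coproduct *)

Section Lowest.
Variables (k : fieldType) (q : k) (I : Type) (A : algType k).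
Hypotheses (q0 : q != 0) (qI : injective (fun d : int => q ^ d)).
Implicit Types (i : I) (s t : seq I) (x y : A).

Variables (E F K KV : I -> A).

Inductive Kmon : A -> Prop :=
| Kmon1 : Kmon 1
| KmonK i g : Kmon g -> Kmon (K i * g)
| KmonKV i g : Kmon g -> Kmon (KV i * g).

(** The span of triangular products, [P] bounding only the number of letters F; for [P] equality
    with n this is the summand U^+ U^0 U^-_n. *)
Definition tri (P : nat -> Prop) : A -> Prop :=
  lspan (fun x => exists s g t,
    [/\ Kmon g, P (size t) & x = word E s * g * word F t]).

Lemma tri_bound (P : nat -> Prop) x :
  tri P x -> exists B, tri (fun n => P n /\ (n < B)%N) x.
Proof.
elim=> [|c y z [s [g [t [hg ht ->]]]] _ [B hB]]; first by exists 0%N; exact: lspan0.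
exists (maxn B (size t).+1); apply: lspan_lin.
  by exists s, g, t; split=> //; split=> //; rewrite leq_max leqnn orbT.
move: hB; apply: lspan_sub => _ [s' [g' [t' [hg' [ht' tB] ->]]]]; apply: lspan_gen.
by exists s', g', t'; split=> //; split=> //; rewrite leq_max tB.
Qed.

Variables (rho rhoV : A).
Hypotheses (rhoKV1 : rho * rhoV = 1) (rhoVK : rhoV * rho = 1).
Hypotheses (rhoE : forall i, adeig q rho rhoV 2 (E i)).
Hypotheses (rhoF : forall i, adeig q rho rhoV (- 2) (F i)).
Hypotheses (rhoK : forall i, adeig q rho rhoV 0 (K i)).
Hypotheses (rhoKV : forall i, adeig q rho rhoV 0 (KV i)).

Variable Delta : A -> tens A A.
Hypotheses (DeltaL : linear Delta) (Delta1 : Delta 1 = tpure 1 1).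
Hypothesis DeltaM : {morph Delta : x y / x * y}.
Hypothesis DeltaE : forall i, Delta (E i) = tpure 1 (E i) + tpure (E i) (KV i).
Hypothesis DeltaF : forall i, Delta (F i) = tpure (F i) 1 + tpure (K i) (F i).
Hypothesis DeltaK : forall i, Delta (K i) = tpure (K i) (K i).
Hypothesis DeltaKV : forall i, Delta (KV i) = tpure (KV i) (KV i).

Variable chev : A -> A.
Hypotheses (chevL : linear chev) (Kmon_chev : forall g, Kmon g -> g * chev g = 1).

Definition Delta3 (x : A) : tens A (tens A A) := tmap idfun Delta (Delta x).

Let idL : linear (@idfun A). Proof. by []. Qed.

Let Dpure x y : tmap idfun Delta (tpure x y) = tpure x (Delta y).
Proof. exact: (tmap_pure idL DeltaL). Qed.

Let DD (x y : tens A A) : tmap idfun Delta (x + y) = tmap idfun Delta x + tmap idfun Delta y.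
Proof. exact: (linear_DZ (tmap_linear idL DeltaL)).1. Qed.

Lemma Delta3_linear : linear Delta3.
Proof. by move=> c x y; rewrite /Delta3 DeltaL (tmap_linear idL DeltaL). Qed.

Lemma Delta3M x y : Delta3 (x * y) = Delta3 x * Delta3 y.
Proof.
by rewrite /Delta3 DeltaM tmapM.
Qed.

Let t3 (x y z : A) : tens A (tens A A) := tpure x (tpure y z).

Let t3M a b c a' b' c' :
  t3 a b c * t3 a' b' c' = t3 (a * a') (b * b') (c * c').
Proof. by apply: etrans (tpureM _ _ _ _) _; congr tpure; exact: tpureM. Qed.

Lemma Delta3_1 : Delta3 1 = t3 1 1 1.
Proof. by rewrite /Delta3 Delta1 Dpure Delta1. Qed.

Lemma Delta3E i :
  Delta3 (E i) = t3 1 1 (E i) + (t3 1 (E i) (KV i) + t3 (E i) (KV i) (KV i)).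
Proof.
apply: etrans (congr1 _ (DeltaE i)) _; apply: etrans (DD _ _) _.
apply: etrans (congr2 +%R (Dpure _ _) (Dpure _ _)) _.
apply: etrans (congr2 (fun u v => tpure 1 u + tpure (E i) v)
  (DeltaE i) (DeltaKV i)) _.
by rewrite tpureDr addrA.
Qed.

Lemma Delta3F i :
  Delta3 (F i) = t3 (F i) 1 1 + (t3 (K i) (F i) 1 + t3 (K i) (K i) (F i)).
Proof.
apply: etrans (congr1 _ (DeltaF i)) _; apply: etrans (DD _ _) _.
apply: etrans (congr2 +%R (Dpure _ _) (Dpure _ _)) _.
apply: etrans (congr2 (fun u v => tpure (F i) u + tpure (K i) v)
  Delta1 (DeltaF i)) _.
by rewrite tpureDr.
Qed.

Lemma Delta3K i : Delta3 (K i) = t3 (K i) (K i) (K i).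
Proof.
apply: etrans (congr1 _ (DeltaK i)) _.
by apply: etrans (Dpure _ _) _; rewrite DeltaK.
Qed.

Lemma Delta3KV i : Delta3 (KV i) = t3 (KV i) (KV i) (KV i).
Proof.
apply: etrans (congr1 _ (DeltaKV i)) _.
by apply: etrans (Dpure _ _) _; rewrite DeltaKV.
Qed.

(* Conjugation by [kap] grades the three factors with weights 2, 1, 0. The
   component of lowest degree of [Delta3 (a * g * b)], for words [a] in the [E]s
   and [b] in the [F]s, is [g * b (x) g (x) a * g]. *)
Let kap := t3 (rho * rho) (rho) 1.
Let kapV := t3 (rhoV * rhoV) (rhoV) 1.
Local Notation low := (lowest q kap kapV).

Let kapVK : kapV * kap = 1.
Proof.
by rewrite tpureM tpureM mulr1 rhoVK mulrA -(mulrA (rhoV)) rhoVK mulr1 rhoVK.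
Qed.

Let kap_adeig d e x y z :
  adeig q (rho) (rhoV) d x -> adeig q (rho) (rhoV) e y ->
  adeig q kap kapV (d + d + e) (t3 x y z).
Proof.
move=> hx hy; rewrite -[e]addr0; apply: adeig_pure => //.
  exact: adeig_conj.
apply: adeig_pure => //.
by rewrite /adeig mul1r mulr1 expr0z scale1r.
Qed.

Let low0M n (x y x0 y0 : tens A (tens A A)) : low 0 x x0 -> low n y y0 -> low n (x * y) (x0 * y0).
Proof. by rewrite -{2}[n]add0r; exact: lowestM. Qed.

Let rho1 : adeig q (rho) (rhoV) 0 1.
Proof. exact: adeig1. Qed.

(** The three terms of [Delta3 (E i)] have degrees 0, 2 and 4, those of [Delta3 (F i)] degrees -4,
    -2 and 0, and the K's have degree 0. The lowest degree of a triangular product is thus -4 times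
    its number of letters F. *)
Lemma lowest_E i : low 0 (Delta3 (E i)) (t3 1 1 (E i)).
Proof.
rewrite Delta3E; apply: lowest_add.
  apply: lowest_hom; exact: kap_adeig rho1 rho1.
apply: lspanD; apply: lspan_gen.
  by exists (0 + 0 + 2) => //; apply: kap_adeig rho1 (rhoE i).
by exists (2 + 2 + 0) => //; apply: kap_adeig (rhoE i) (rhoKV i).
Qed.

Lemma lowest_F i : low (- 4) (Delta3 (F i)) (t3 (F i) 1 1).
Proof.
rewrite Delta3F; apply: lowest_add.
  apply: lowest_hom; exact: kap_adeig (rhoF i) rho1.
apply: lspanD; apply: lspan_gen.
  by exists (0 + 0 - 2) => //; apply: kap_adeig (rhoK i) (rhoF i).
by exists (0 + 0 + 0) => //; apply: kap_adeig (rhoK i) (rhoK i).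
Qed.

Lemma lowest_K g : Kmon g -> low 0 (Delta3 g) (t3 g g g).
Proof.
elim=> [|i h _ IH|i h _ IH].
- by rewrite Delta3_1; apply: lowest_hom; exact: kap_adeig rho1 rho1.
- rewrite Delta3M Delta3K -(t3M _ _ _ h h h); apply: low0M IH.
  by apply: lowest_hom; exact: kap_adeig (rhoK i) (rhoK i).
- rewrite Delta3M Delta3KV -(t3M _ _ _ h h h); apply: low0M IH.
  by apply: lowest_hom; exact: kap_adeig (rhoKV i) (rhoKV i).
Qed.

Lemma lowest_Eword s : low 0 (Delta3 (word E s)) (t3 1 1 (word E s)).
Proof.
elim: s => [|i s IH].
  rewrite word_nil Delta3_1.
  by apply: lowest_hom; exact: kap_adeig rho1 rho1.
have e := t3M 1 1 (E i) 1 1 (word E s); rewrite -word_cons (mulr1 1) in e.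
rewrite -e.
rewrite word_cons Delta3M.
exact: low0M (lowest_E i) IH.
Qed.

Lemma lowest_Fword s :
  low (- (4 * size s)%N%:Z) (Delta3 (word F s)) (t3 (word F s) 1 1).
Proof.
elim: s => [|i s IH].
  rewrite muln0 oppr0 word_nil Delta3_1.
  by apply: lowest_hom; exact: kap_adeig rho1 rho1.
have e := t3M (F i) 1 1 (word F s) 1 1; rewrite -word_cons (mulr1 1) in e.
rewrite -e.
rewrite word_cons Delta3M.
have -> : - (4 * size (i :: s))%N%:Z = - 4 + - (4 * size s)%N%:Z.
  by rewrite /= mulnS PoszD opprD.
exact: (lowestM q0 kapVK (lowest_F i) IH).
Qed.

Lemma lowest_tri s g t : Kmon g ->
  low (- (4 * size t)%N%:Z) (Delta3 (word E s * g * word F t))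
    (t3 (g * word F t) g (word E s * g)).
Proof.
move=> hg.
have e1 := t3M 1 1 (word E s) g g g; have e2 := t3M g g (word E s * g) (word F t) 1 1.
rewrite (mul1r g) in e1; rewrite (mulr1 g) (mulr1 (_ * g)) -e1 in e2.
rewrite -e2 (Delta3M _ (word F t)) (Delta3M (word E s)).
exact: low0M (low0M (lowest_Eword s) (lowest_K hg)) (lowest_Fword t).
Qed.

Let mu2 : tens A A -> A := tlift (fun y w => w * chev y).

Let mu2_bal : balanced (fun y w : A => w * chev y).
Proof.
have [cD cZ] := linear_DZ chevL.
split=> [u v w|u v w|c u v]; first by rewrite cD mulrDr.
  by rewrite mulrDl.
by rewrite cZ -scalerAl -scalerAr.
Qed.

Let mu2L : linear mu2.
Proof.
apply: tlift_linear => // c v w.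
by rewrite (linear_DZ chevL).2 -scalerAr.
Qed.

(** The recovery map: it sends [t3 (g * b) g (a * g)] to [a * g * chev g * (g * b)], which is
    [a * g * b] because [chev g] inverts [g]. *)
Let mu3 : tens A (tens A A) -> A := tlift (fun z v => mu2 v * z).

Let mu3_bal : balanced (fun (z : A) v => mu2 v * z).
Proof.
have [mD mZ] := linear_DZ mu2L.
split=> [u v w|u v w|c u v]; first by rewrite mulrDr.
  by rewrite mD mulrDl.
by rewrite mZ -scalerAl -scalerAr.
Qed.

Let mu3L : linear mu3.
Proof. by apply: tlift_linear => // c v w; rewrite -scalerAr. Qed.

Let mu3E x y z : mu3 (t3 x y z) = z * chev y * x.
Proof. by rewrite /mu3 tlift_pure // /mu2 tlift_pure. Qed.

(** All terms of [x] have the same lowest degree, so their lowest components add up to a component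
    [X] of [Delta3 x], from which [mu3] recovers [x]. *)
Lemma tri_lowest N x : tri (fun n => n = N) x ->
  exists X, low (- (4 * N)%N%:Z) (Delta3 x) X /\ mu3 X = x.
Proof.
have [d3D d3Z] := linear_DZ Delta3_linear; have [mD mZ] := linear_DZ mu3L.
elim=> [|c y z [s [g [t [hg <- ->]]]] _ [X [hX XE]]].
  exists 0; have -> : Delta3 0 = 0 by rewrite -(scale0r (0 : A)) d3Z scale0r.
  split; last by rewrite -(scale0r 0) mZ scale0r.
  by apply: lowest_hom; rewrite /adeig mulr0 mul0r scaler0.
exists (c *: t3 (g * word F t) g (word E s * g) + X); split.
  by rewrite Delta3_linear; apply: lowest_comb => //; exact: lowest_tri.
by rewrite mu3L mu3E XE -(mulrA _ g (chev g)) Kmon_chev // mulr1 mulrA.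
Qed.

(** [Delta3 y] lives in degrees above -4N, so the component [X] of [Delta3 x] in degree -4N is that
    of [Delta3 (x + y) = 0]. Hence [X = 0], and [x = mu3 X] vanishes. *)
Lemma tri_top_eq0 N x y : tri (fun n => n = N) x ->
  tri (fun n => n < N)%N y -> x + y = 0 -> x = 0.
Proof.
have [d3D d3Z] := linear_DZ Delta3_linear.
move=> /tri_lowest[X [[eX hX] XE]] hy xy0.
suff X0 : X = 0 by rewrite -XE X0 -(scale0r 0) (linear_DZ mu3L).2 scale0r.
apply: (lowest_eq0 qI eX).
have -> : X = (-1) *: (Delta3 x - X) + (-1) *: Delta3 y.
  have D0 : Delta3 0 = 0 by rewrite -(scale0r (0 : A)) d3Z scale0r.
  have -> : Delta3 y = - Delta3 x.
    by apply: (addrI (Delta3 x)); rewrite -d3D xy0 D0 subrr.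
  by rewrite !scaleN1r opprB opprK subrK.
apply: lspanD; apply: lspanZ => //.
move: hy; apply: (lspan_map Delta3_linear) => _ [s [g [t [hg tN ->]]]].
by apply: lowest_gt0 (lowest_tri s t hg); lia.
Qed.

(** The second expression of [x] involves lengths in a bounded range from [N] on; its terms of
    greatest length are removed one length at a time by [tri_top_eq0]. *)
Lemma tri_disjoint N x : tri (fun n => n < N)%N x ->
  tri (fun n => N <= n)%N x -> x = 0.
Proof.
move=> hx /tri_bound[B hB].
have {hB} : tri (fun n => N <= n /\ n < N + (B - N))%N x.
  move: hB; apply: lspan_sub => _ [s [g [t [hg [ht tB] ->]]]]; apply: lspan_gen.
  by exists s, g, t; split=> //; split=> //; lia.
elim: (B - N)%N => [|m IH].
  (* The range of lengths is empty, so only the zero combination occurs. *)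
  elim=> [//|c y z [s [g [t [_ [h1 h2] _]]]]]; lia.
move=> h; have [|y [z [hy hz xE]]] := lspan_split
  (T1 := fun x => exists s g t,
    [/\ Kmon g, (N <= size t /\ size t < N + m)%N & x = word E s * g * word F t])
  (T2 := fun x => exists s g t,
    [/\ Kmon g, size t = (N + m)%N & x = word E s * g * word F t]) _ h.
  move=> _ [s [g [t [hg [h1 h2] ->]]]].
  have [e|ne] := eqVneq (size t) (N + m)%N; first by right; exists s, g, t.
  by left; exists s, g, t; split=> //; split=> //; lia.
have z0 : z = 0.
  (* In the vanishing sum [z + (y - x)] the terms of [y] are shorter than [N + m] and those of [x]
     shorter than [N]. *)
  apply: (@tri_top_eq0 (N + m) z (y - x)) => //; last first.
    by rewrite xE addrA [z + y]addrC subrr.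
  apply: lspanB.
    move: hy; apply: lspan_sub => _ [s [g [t [hg [h1 h2] ->]]]]; apply: lspan_gen.
    by exists s, g, t.
  move: hx; apply: lspan_sub => _ [s [g [t [hg h1 ->]]]]; apply: lspan_gen.
  by exists s, g, t; split=> //; lia.
by apply: IH; rewrite xE z0 addr0.
Qed.

End Lowest.

(** * Triangular form in U, and the intersection of the F_N *)

Section Hausdorff.
Variables (k : fieldType) (q : k) (r : nat).
Hypotheses (q0 : q != 0) (qI : injective (fun d : int => q ^ d)).
Local Notation U := (U q r).
Local Notation Idx := 'I_(r.*2.+1).
Local Notation E i := (UE q i).
Local Notation F i := (UF q i).
Local Notation K i := (UK q i).
Local Notation KV i := (UKV q i).
Local Notation Fword := (word (@UF _ q r)).
Local Notation Eword := (word (@UE _ q r)).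
Implicit Types (i j : Idx) (s t : seq Idx) (x y : U).

Local Notation Kmon := (Kmon (@UK _ q r) (@UKV _ q r)).
Local Notation tri := (tri (@UE _ q r) (@UF _ q r) (@UK _ q r) (@UKV _ q r)).

Lemma Kmon_comm g i : Kmon g -> g * K i = K i * g /\ g * KV i = KV i * g.
Proof.
elim=> [|j h _ [hK hKV]|j h _ [hK hKV]]; first by rewrite !mulr1 !mul1r.
  by rewrite -!mulrA hK hKV !mulrA UKC KKV_comm.
by rewrite -!mulrA hK hKV !mulrA UKVC -KKV_comm.
Qed.

(** The Chevalley map inverts each K, and the K's commute. *)
Lemma Kmon_chevalley g : Kmon g -> g * chevalley g = 1.
Proof.
elim=> [|i h hh IH|i h hh IH]; first by rewrite chevalley1 // mulr1.
  rewrite chevalleyM // (chevalley_gen q0 (GenK i)) /= mulrA -(mulrA (K i)).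
  by rewrite (Kmon_comm i hh).2 mulrA UKKV mul1r.
rewrite chevalleyM // (chevalley_gen q0 (GenKV i)) /= mulrA -(mulrA (KV i)).
by rewrite (Kmon_comm i hh).1 mulrA UKVK mul1r.
Qed.

Lemma KEword i s : exists c, K i * Eword s = c *: (Eword s * K i).
Proof.
elim: s => [|j s [c IH]].
  by exists 1; rewrite word_nil mulr1 mul1r scale1r.
exists (q ^ Defs.form (alpha i) (alpha j) * c).
rewrite word_cons mulrA -[X in X * _]mulr1 -(UKVK q i) !mulrA UKE.
by rewrite -!scalerAl -mulrA IH -!scalerAr scalerA mulrA.
Qed.

Lemma KVEword i s : exists c, KV i * Eword s = c *: (Eword s * KV i).
Proof.
elim: s => [|j s [c IH]].
  by exists 1; rewrite word_nil mulr1 mul1r scale1r.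
have h := conj_inv (expfz_neq0 _ q0) (UKVK q i) (UKE q i j).
exists ((q ^ Defs.form (alpha i) (alpha j))^-1 * c).
rewrite word_cons mulrA -[X in X * _]mulr1 -(UKKV q i) !mulrA h.
by rewrite -!scalerAl -mulrA IH -!scalerAr scalerA mulrA.
Qed.

Lemma tri_mulE P i x : tri P x -> tri P (E i * x).
Proof.
apply: (lspan_map (mulL_linear _)) => _ [s [g [t [hg ht ->]]]].
by apply: lspan_gen; exists (i :: s), g, t; rewrite word_cons !mulrA.
Qed.

Lemma tri_mulK P i x : tri P x -> tri P (K i * x).
Proof.
apply: (lspan_map (mulL_linear _)) => _ [s [g [t [hg ht ->]]]].
have [c hc] := KEword i s; rewrite !mulrA hc -!scalerAl; apply/lspanZ/lspan_gen.
by exists s, (K i * g), t; split; rewrite ?mulrA //; exact: KmonK.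
Qed.

Lemma tri_mulKV P i x : tri P x -> tri P (KV i * x).
Proof.
apply: (lspan_map (mulL_linear _)) => _ [s [g [t [hg ht ->]]]].
have [c hc] := KVEword i s; rewrite !mulrA hc -!scalerAl; apply/lspanZ/lspan_gen.
by exists s, (KV i * g), t; split; rewrite ?mulrA //; exact: KmonKV.
Qed.

Lemma Kmon_F g i : Kmon g -> exists c, F i * g = c *: (g * F i).
Proof.
elim=> [|j h _ [c IH]|j h _ [c IH]].
- by exists 1; rewrite mulr1 mul1r scale1r.
- have [d hd] := FK q0 j i; exists (d * c).
  by rewrite mulrA hd -scalerAl -!mulrA IH -scalerAr scalerA.
- have [d hd] := FKV q j i; exists (d * c).
  by rewrite mulrA hd -scalerAl -!mulrA IH -scalerAr scalerA.
Qed.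

(** [F i] is moved to the right through the letters E; a commutator leaves K's, which [tri_mulK] and
    [tri_mulKV] put in place. The main term gains a letter F and the commutator terms do not, so no
    general [P] is preserved. *)
Lemma tri_mulF i x : tri (fun=> True) x -> tri (fun=> True) (F i * x).
Proof.
apply: (lspan_map (mulL_linear _)) => _ [s [g [t [hg _ ->]]]].
elim: s => [|j s IH].
  have [c hc] := Kmon_F i hg.
  rewrite word_nil mul1r mulrA hc -scalerAl -mulrA -word_cons.
  by apply/lspanZ/lspan_gen; exists [::], g, (i :: t); rewrite word_nil mul1r.
rewrite word_cons !mulrA.
have -> : F i * E j =
    E j * F i - (if j == i then (q - q^-1)^-1 *: (K j - KV j) else 0).
  by rewrite -UEF subKr.
rewrite !mulrBl; apply: lspanB.
  by rewrite -!mulrA; apply: (@tri_mulE (fun=> True)); rewrite !mulrA; move: IH; rewrite !mulrA.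
case: eqP => _; last by rewrite !mul0r; exact: lspan0.
have h : tri (fun=> True) (Eword s * g * Fword t) by apply: lspan_gen; exists s, g, t.
rewrite -!scalerAl !mulrBl; apply/lspanZ/lspanB; rewrite -!mulrA.
  by apply: (@tri_mulK (fun=> True)); rewrite !mulrA.
by apply: (@tri_mulKV (fun=> True)); rewrite !mulrA.
Qed.

Lemma tri_total x : tri (fun=> True) x.
Proof.
elim/U_word_ind: x => [c x y||g x].
- exact: lspan_comb.
- apply: lspan_gen; exists [::], 1, [::]; split=> //; first exact: Kmon1.
  by rewrite !word_nil !mulr1.
- case: g => i; [exact: tri_mulE|exact: tri_mulF|exact: tri_mulK|exact: tri_mulKV].
Qed.

Lemma Ffilt_tri N x : Ffilt N x -> tri (fun n => N <= n)%N x.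
Proof.
apply: lspan_sub => _ [y [s [sN ->]]].
move: (tri_total y); apply: (lspan_map (mulR_linear _)) => _ [s' [g [t [hg _ ->]]]].
apply: lspan_gen; exists s', g, (t ++ s); split=> //.
  by rewrite size_cat sN leq_addl.
by rewrite word_cat mulrA.
Qed.

Variables (Delta : {lrmorphism U -> tens U U}).
Hypothesis HDelta : is_coproduct Delta.

Let Delta1 : Delta 1 = tpure 1 1. Proof. exact: rmorph1. Qed.
Let DeltaM x y : Delta (x * y) = Delta x * Delta y. Proof. exact: rmorphM. Qed.

(** [is_coproduct] prescribes the value at [K i]; multiplicativity forces the one at its inverse. *)
Lemma DeltaKV i : Delta (KV i) = tpure (KV i) (KV i).
Proof.
have [_ _ hK] := HDelta.
have e : Delta (KV i) * tpure (K i) (K i) = 1 by rewrite -hK -DeltaM UKVK Delta1.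
have e' : tpure (K i) (K i) * tpure (KV i) (KV i) = 1 :> tens U U.
  by rewrite tpureM UKKV.
exact: mul_inv_uniq e e'.
Qed.

(** Some triangular expression of [x] has fewer than [A] letters F in each term; membership in F_A
    gives another with at least [A]. The two are compared by [tri_disjoint]. *)
Lemma Ffilt_separated x : (forall N, Ffilt N x) -> x = 0.
Proof.
move=> hx; have [A hA] := tri_bound (tri_total x).
have DeltaL : linear Delta by exact: linearP.
have [DE DF DK] := HDelta.
have chevL : linear (@chevalley k q r) by exact: chevalley_linear.
apply: (tri_disjoint q0 qI (KprodV q (two_rho r)) (KVprodK q (two_rho r))
  (KrhoE q0) (KrhoF q0) (KrhoK q0) (KrhoKV q0) DeltaL Delta1 DeltaM DE DF DK
  DeltaKV chevL Kmon_chevalley (N := A)); last exact/Ffilt_tri.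
move: hA; apply: lspan_sub => _ [s [g [t [hg [_ h1] ->]]]]; apply: lspan_gen.
by exists s, g, t.
Qed.

End Hausdorff.

(** * Convergence in the completions *)

Lemma ceq_eq (F : fieldType) (A : algType F) (H : nat -> A -> Prop) s t :
  filtration H -> s =1 t -> ceq H s t.
Proof. by move=> fH st N; exists 0%N => n _; rewrite st subrr; exact: filt0. Qed.

Section PartialSums.
Variables (r : nat).

(** Ensures that [psum] is a genuine sum, as a sum over an infinite support would default to 0. *)
Lemma ht_finite n : finite_set [set mu : NPi r | (ht mu < n)%N].
Proof.
pose f (g : {ffun 'I_(r.*2.+1) -> 'I_n}) : NPi r := [ffun i => val (g i)].
have ff : finite_set (f @` setT) by apply: finite_image; exact: finite_finset.
apply: (sub_finite_set _ ff).
move=> mu /= mun.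
have lt i : (mu i < n)%N.
  by apply: leq_ltn_trans mun; rewrite /ht (bigD1 i) //= leq_addr.
exists [ffun i => Ordinal (lt i)] => //.
by apply/ffunP => i; rewrite !ffunE.
Qed.

Lemma psum_sub (V : zmodType) (P : V -> Prop) (X : NPi r -> V) m n N :
  P 0 -> (forall x y, P x -> P y -> P (x + y)) ->
  (forall mu, (N <= ht mu)%N -> P (X mu)) -> (N <= m)%N -> (m <= n)%N ->
  P (psum X n - psum X m).
Proof.
move=> P0 PD PX Nm mn; rewrite /psum.
rewrite (fsbigID [set mu : NPi r | (ht mu < m)%N]%classic); last exact: ht_finite.
have -> : ([set mu : NPi r | (ht mu < n)%N] `&` [set mu | (ht mu < m)%N] =
    [set mu | (ht mu < m)%N])%classic.
  by apply/seteqP; split=> [mu []|mu /= h] //; split=> //; exact: leq_trans h mn.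
rewrite addrAC subrr add0r fsbig_finite; last by apply: finite_setIl; exact: ht_finite.
rewrite big_seq; apply: big_ind => // mu.
rewrite in_fset_set; last by apply: finite_setIl; exact: ht_finite.
rewrite inE => -[_] /= /negP; rewrite -leqNgt => h.
by apply: PX; exact: leq_trans h.
Qed.

End PartialSums.

Section Convergence.
Variables (k : fieldType) (q : k) (r : nat).
Hypotheses (q0 : q != 0) (qI : injective (fun d : int => q ^ d)).
Local Notation U := (U q r).
Local Notation H := (@Ffilt k q r).
Local Notation G := (tfilt H H).
Local Notation F := (@UF k q r).

Lemma UUfilt_tfilt N (x : tens U U) : UUfilt N x -> G N x.
Proof.
apply: lspan_sub => _ [a [b [hab ->]]]; apply: lspan_gen; exists a, b; split=> //.
by case: hab => /(Ufilt_Ffilt q0 qI); [left|right].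
Qed.

Variable Delta : {lrmorphism U -> tens U U}.
Hypothesis HDelta : is_coproduct Delta.

Let DeltaM x y : Delta (x * y) = Delta x * Delta y. Proof. exact: rmorphM. Qed.

(** Counts the letters F of both factors together: [Delta] sends each letter F to one factor or the
    other, so the total is kept. *)
Let height (n : nat) : tens U U -> Prop :=
  lspan (fun x => exists i j a b,
    [/\ H i a, H j b, (i + j = n)%N & x = tpure a b]).

Lemma height_Fword s : height (size s) (Delta (word F s)).
Proof.
have [_ DF _] := HDelta.
elim/last_ind: s => [|s i IH].
  rewrite word_nil (_ : Delta 1 = tpure 1 1); last exact: rmorph1.
  apply: lspan_gen; exists 0%N, 0%N, 1, 1.
  have H1 : H 0 1.
    by apply: lspan_gen; exists 1, [::]; rewrite word_nil mulr1.
  by split.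
rewrite word_rcons size_rcons DeltaM.
apply: (eq_ind_r (fun z => height _ (Delta (word F s) * z)) _ (DF i)).
move: IH; apply: (lspan_map (mulR_linear _)) => _ [m [n [a [b [ha hb <- ->]]]]].
rewrite mulrDr; apply: lspanD; apply: lspan_gen.
  exists m.+1, n, (a * F i), (b * 1); split; last exact: tpureM.
  - exact: FfiltMF.
  - by rewrite mulr1.
  - by [].
exists m, n.+1, (a * UK q i), (b * F i); split; last exact: tpureM.
- exact: FfiltMK (FK q0 i) ha.
- exact: FfiltMF.
- by rewrite addnS.
Qed.

(** When 2N letters are shared between two factors, one of them receives at least N. This gives the
    continuity of [Delta]. *)
Lemma Delta_Ffilt N x : H (N + N)%N x -> G N (Delta x).
Proof.
have DL : linear Delta by exact: linearP.
have fH := Ffilt_filtration r q0; have fG := tfilt_filtration fH fH.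
apply: (lspan_map DL) => _ [y [s [sN ->]]]; rewrite DeltaM; apply: (filtMl fG).
move: (height_Fword s); apply: lspan_sub => _ [m [n [a [b [ha hb mn ->]]]]].
apply: lspan_gen; exists a, b; split=> //.
have [Nm|mN] := leqP N m; first by left; exact: (filt_le fH Nm ha).
by right; apply: (filt_le fH _ hb); lia.
Qed.

Lemma Delta_ceq s t : ceq H s t -> ceq G (Delta \o s) (Delta \o t).
Proof.
move=> st N; have [n0 h] := st (N + N)%N; exists n0 => n /h /Delta_Ffilt /=.
by rewrite raddfB.
Qed.

Lemma Theta_cauchy (Theta : NPi r -> tens U U) :
  (forall mu, tspan (Uplus_wt mu) (Uminus_wt mu) (Theta mu)) ->
  cauchy G (psum Theta).
Proof.
move=> hT N; exists N.
have fH := Ffilt_filtration r q0; have fG := tfilt_filtration fH fH.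
have hG mu : (N <= ht mu)%N -> G N (Theta mu).
  move=> Nmu; move: (hT mu); apply: lspan_sub => _ [a [b [_ hb ->]]].
  apply: lspan_gen; exists a, b; split=> //; right.
  exact: Uminus_wt_Ffilt Nmu.
have GN : G N 0 by exact: filt0.
have GD (x y : tens U U) : G N x -> G N y -> G N (x + y) by exact: lspanD.
have main m n : (N <= m)%N -> (m <= n)%N -> G N (psum Theta n - psum Theta m).
  exact: psum_sub.
move=> m n Nm Nn; have [mn|/ltnW nm] := leqP m n; last exact: main.
by rewrite -opprB -scaleN1r; apply/lspanZ/main.
Qed.

End Convergence.

Section AntilinearTensor.
Variables (F : fieldType) (V W V' W' : lmodType F) (s : F -> F).
Variables (f : V -> V') (g : W -> W').
Hypotheses (fD : {morph f : u v / u + v}) (gD : {morph g : u v / u + v}).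
Hypothesis fZ : forall c v, f (c *: v) = s c *: f v.
Hypothesis gZ : forall c w, g (c *: w) = s c *: g w.

Lemma tmap_pure_semi v w : tmap f g (tpure v w) = tpure (f v) (g w).
Proof. exact: (tlift_pure (tmap_balanced fD gD fZ gZ)). Qed.

Lemma tmapB_semi : zmod_morphism (tmap f g).
Proof. exact: (tliftB (tmap_balanced fD gD fZ gZ)). Qed.

End AntilinearTensor.

(** * The bar maps are involutions *)

Section Involutions.
Variables (k : fieldType) (q : k) (bar : k -> k) (r : nat).
Hypothesis barK : involutive bar.
Local Notation U := (U q r).
Local Notation Ui := (Ui q r).

(** The square of [psi] is linear and multiplicative and fixes the generators; the value of [psi] at
    the inverse of [UK q i] is forced by uniqueness of inverses. *)
Lemma bar_involutive (psi : {rmorphism U -> U}) : is_bar bar psi -> involutive psi.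
Proof.
move=> [pZ [pE pF pK]].
have pM x y : psi (x * y) = psi x * psi y by exact: rmorphM.
have pD x y : psi (x + y) = psi x + psi y by exact: rmorphD.
have p1 : psi 1 = 1 by exact: rmorph1.
have pKV i : psi (UKV q i) = UK q i.
  have e : UKV q i * psi (UKV q i) = 1 by rewrite -[X in X * _]pK -pM UKKV p1.
  exact/esym/(mul_inv_uniq (UKKV q i) e).
elim/U_word_ind => [c x y hx hy||g x hx]; last first.
- rewrite !pM hx; congr (_ * _).
  case: g => i.
  + by apply: etrans (congr1 psi (pE i)) (pE i).
  + by apply: etrans (congr1 psi (pF i)) (pF i).
  + by apply: etrans (congr1 psi (pK i)) (pKV i).
  + by apply: etrans (congr1 psi (pKV i)) (pK i).
- by rewrite !p1.
- by rewrite !pD !pZ barK hx hy.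
Qed.

Lemma Ui_ind (P : Ui -> Prop) :
  P 1 -> (forall c x y, P x -> P y -> P (c *: x + y)) ->
  (forall x y, P x -> P y -> P (x * y)) ->
  (forall x (gx : Ui_gen x), P (Ui_of gx)) -> forall u, P u.
Proof.
move=> P1 Plin PM Pg u.
have vI : injective (@Ui_val k q r) by exact: val_inj.
suff main x : subalg (@Ui_gen k q r) x -> forall v : Ui, Ui_val v = x -> P v.
  by apply: (main (Ui_val u)) => //; apply/asboolP; exact: Ui_valP.
elim=> {x} [x gx||c x y hx IHx hy IHy|x y hx IHx hy IHy] => v hv.
- by have -> : v = Ui_of gx by apply: vI.
- by have -> : v = 1 by apply: vI.
- pose X : Ui := MkUi (asboolT hx); pose Y : Ui := MkUi (asboolT hy).
  have -> : v = c *: X + Y by apply: vI.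
  by apply: Plin; [exact: IHx | exact: IHy].
- pose X : Ui := MkUi (asboolT hx); pose Y : Ui := MkUi (asboolT hy).
  have -> : v = X * Y by apply: vI.
  by apply: PM; [exact: IHx | exact: IHy].
Qed.

Lemma ibar_involutive (psii : {rmorphism Ui -> Ui}) :
  is_ibar bar psii -> involutive psii.
Proof.
move=> [pZ [pe pf pt pk]].
have pM x y : psii (x * y) = psii x * psii y by exact: rmorphM.
have pD x y : psii (x + y) = psii x + psii y by exact: rmorphD.
have p1 : psii 1 = 1 by exact: rmorph1.
have vI : injective (@Ui_val k q r) by exact: val_inj.
have kkV (i : 'I_r) : Uik q i * UikV q i = 1.
  apply: vI; rewrite -[LHS]/(UK q (idxp i) * UKV q (idxn i) *
    (UK q (idxn i) * UKV q (idxp i))).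
  by rewrite mulrA -(mulrA (UK q (idxp i))) UKVK mulr1 UKKV.
have pkV (i : 'I_r) : psii (UikV q i) = Uik q i.
  have e : UikV q i * psii (UikV q i) = 1 by rewrite -[X in X * _]pk -pM kkV p1.
  exact/esym/(mul_inv_uniq (kkV i) e).
elim/Ui_ind => [|c x y hx hy|x y hx hy|x gx].
- by rewrite !p1.
- by rewrite !pD !pZ barK hx hy.
- by rewrite !pM hx hy.
suff h y (gy : Ui_gen y) (u : Ui) : Ui_val u = y -> psii (psii u) = u.
  exact: (h x gx).
case: gy u => [i|i|i|i|] u hu.
- by have -> : u = Uik q i; [exact: vI | rewrite pk pkV].
- by have -> : u = UikV q i; [exact: vI | rewrite pkV pk].
- by have -> : u = Uie q i; [exact: vI | rewrite !pe].
- by have -> : u = Uif q i; [exact: vI | rewrite !pf].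
- by have -> : u = Uit q r; [exact: vI | rewrite !pt].
Qed.

End Involutions.

(** * The identity in the completion of U (x) U *)

Section Commutation.
Variables (k : fieldType) (q : k) (bar : k -> k) (r : nat).
Hypotheses (q0 : q != 0) (qI : injective (fun d : int => q ^ d)).
Hypothesis barK : involutive bar.
Local Notation U := (U q r).
Local Notation Ui := (Ui q r).
Local Notation H := (@Ffilt k q r).
Local Notation G := (tfilt H H).
Variables (Delta : {lrmorphism U -> tens U U}) (HDelta : is_coproduct Delta).
Variables (psi : {rmorphism U -> U}) (Hpsi : is_bar bar psi).
Variables (psii : {rmorphism Ui -> Ui}) (Hpsii : is_ibar bar psii).
Variables (Deltai : Ui -> tens Ui U).
Hypothesis HDeltai : is_restricted_coproduct Delta Deltai.
Variables (Upsilon : NPi r -> U) (HUpsilon : is_intertwiner psi psii Upsilon).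
Variables (Upsilon_inv : nat -> U).
Hypothesis HUpsilon_inv : cinverse (@Ufilt k q r) (psum Upsilon) Upsilon_inv.
Variables (Theta : NPi r -> tens U U) (HTheta : is_quasiR Delta psi Theta).

Local Notation s := (psum Upsilon).
Local Notation t := Upsilon_inv.
Local Notation th := (psum Theta).
Let fH : filtration H. Proof. exact: Ffilt_filtration. Qed.
Let fG : filtration G. Proof. exact: tfilt_filtration. Qed.
Let UH N x : Ufilt N x -> H N x. Proof. exact: Ufilt_Ffilt. Qed.
Let UG N (x : tens U U) : UUfilt N x -> G N x. Proof. exact: UUfilt_tfilt. Qed.

Let tC : cauchy H t.
Proof. by case: HUpsilon_inv => h _ _; exact: cauchy_sub h. Qed.

Let intertwine (u : Ui) :
  ceq H (fun n => val (psii u) * s n) (fun n => s n * psi (val u)).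
Proof. by case: HUpsilon => _ _ /(_ u); exact: ceq_sub. Qed.

(** Multiply the intertwining relation of Upsilon by its inverse on both sides. *)
Lemma Upsilon_inv_intertwines (a : Ui) :
  ceq H (fun n => psi (val a) * t n) (fun n => t n * val (psii a)).
Proof.
have [_ /(ceq_sub UH) st /(ceq_sub UH) ts] := HUpsilon_inv.
have c1 := ceqMr fH tC (ceqMr fH (cauchy_cst fH (psi (val a))) ts).
have c2 := ceqMr fH tC (ceqMl fH t (intertwine a)).
have c3 := ceqMl fH (fun n => t n * val (psii a)) st.
apply: (ceq_trans fH (t := fun n => 1 * psi (val a) * t n)).
  by apply: (ceq_eq fH) => n; rewrite mul1r.
apply: (ceq_trans fH (ceq_sym fH c1)).
apply: (ceq_trans fH (t := fun n => t n * (s n * psi (val a)) * t n)).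
  by apply: (ceq_eq fH) => n; rewrite !mulrA.
apply: (ceq_trans fH (ceq_sym fH c2)).
apply: (ceq_trans fH (t := fun n => t n * val (psii a) * (s n * t n))).
  by apply: (ceq_eq fH) => n; rewrite !mulrA.
apply: (ceq_trans fH c3).
by apply: (ceq_eq fH) => n; rewrite mulr1.
Qed.

(** On a pure tensor the first factor is [Upsilon_inv_intertwines], while the second is [psi b] on
    both sides. Additivity suffices for the rest, the maps being anti-linear. *)
Lemma bar_Upsilon_inv (z : tens Ui U) :
  ceq G (fun n => tmap psi psi (tmap val id z) * tpure (t n) 1)
        (fun n => tpure (t n) 1 * tmap val id (tmap psii psi z)).
Proof.
have [pZ _] := Hpsi; have [piZ _] := Hpsii.
have pD x y : psi (x + y) = psi x + psi y by exact: rmorphD.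
have piD x y : psii (x + y) = psii x + psii y by exact: rmorphD.
have vL : linear (val : Ui -> U) by [].
have iL : linear (id : U -> U) by [].
have vB (x y : tens Ui U) : tmap val id (x - y) = tmap val id x - tmap val id y.
  have [tD tZ] := linear_DZ (tmap_linear vL iL).
  by rewrite -scaleN1r tD tZ scaleN1r.
have pB := tmapB_semi pD pD pZ pZ; have piB := tmapB_semi piD pD piZ pZ.
elim/tens_ind: z => [|x y hx hy|a b].
- have v0 : tmap val id (0 : tens Ui U) = 0 by have := vB 0 0; rewrite !subrr.
  have p0 : tmap psi psi 0 = 0 by have := pB 0 0; rewrite !subrr.
  have pi0 : tmap psii psi 0 = 0 by have := piB 0 0; rewrite !subrr.
  apply: (ceq_eq fG) => n; rewrite v0 p0 pi0 v0.
  exact: etrans (mul0r _) (esym (mulr0 _)).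
- have c := ceqD fG hx (ceqZ fG (-1) hy).
  apply: (ceq_trans fG _ (ceq_trans fG c _)); apply: (ceq_eq fG) => n.
    by rewrite vB pB mulrBl scaleN1r.
  by rewrite piB vB mulrBr scaleN1r.
have e1 n : tmap psi psi (tmap val id (tpure a b)) * tpure (t n) 1 =
    tpure (psi (val a) * t n) (psi b).
  rewrite (tmap_pure vL iL) (tmap_pure_semi pD pD pZ pZ).
  by apply: etrans (tpureM _ _ _ _) _; rewrite mulr1.
have e2 n : tpure (t n) 1 * tmap val id (tmap psii psi (tpure a b)) =
    tpure (t n * val (psii a)) (psi b).
  rewrite (tmap_pure_semi piD pD piZ pZ) (tmap_pure vL iL).
  by apply: etrans (tpureM _ _ _ _) _; rewrite mul1r.
apply: (ceq_trans fG (ceq_eq fG e1)).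
apply: (ceq_trans fG _ (ceq_sym fG (ceq_eq fG e2))).
exact: ceq_mapl (Upsilon_inv_intertwines a).
Qed.

Variables (Thetai : nat -> tens Ui U).
Hypothesis HThetai : is_quasiRi Delta Upsilon Upsilon_inv Theta Thetai.
Local Notation w := (fun n => \sum_(N < n) tmap val id (Thetai N)).

Let TC : cauchy G (fun n => tpure (t n) (1 : U)).
Proof.
move=> N; have [n0 h] := tC N; exists n0 => m n mn nn.
apply: lspan_gen; exists (t m - t n), 1; split; first by left; exact: h.
have -> : t m - t n = (-1) *: t n + t m by rewrite scaleN1r addrC.
by rewrite tpure_linl scaleN1r addrC.
Qed.

Let thC : cauchy G th.
Proof. by case: HTheta => h _ _; exact: Theta_cauchy. Qed.

Lemma quasiRi_commutes (u : Ui) :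
  ceq G (fun n => Delta (val u) * w n)
        (fun n => w n * tmap val id (bar_coproduct psi psii Deltai u)).
Proof.
(* Writing [u] as [psii v] allows the intertwining relation to be used at [v]. *)
pose v := psii u; have uE : psii v = u by exact: (ibar_involutive barK Hpsii).
have [_ /(ceq_sub UG) hw] := HThetai.
have DM x y : Delta (x * y) = Delta x * Delta y by exact: rmorphM.
pose T n : tens U U := tpure (t n) 1.
pose D x : tens U U := Delta x.
have e1 := ceqMl fG (fun=> D (val u)) (ceq_sym fG hw).
have i1 := Delta_ceq q0 HDelta (intertwine v); rewrite uE in i1.
have e2 := ceqMr fG TC (ceqMr fG thC i1).
(* At [psi (val v)] the inner [psi] cancels, leaving [Delta (val v)], which comes from
   [Deltai v]. *)
have [_ _ /(_ (psi (val v)))/(ceq_sub UG) i2] := HTheta.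
rewrite (bar_involutive barK Hpsi) -HDeltai in i2.
have e3 := ceqMr fG TC (ceqMl fG (fun n => D (s n)) i2).
have e4 := ceqMl fG (fun n => D (s n) * th n) (bar_Upsilon_inv (Deltai v)).
have e5 := ceqMr fG (cauchy_cst fG (tmap val id (tmap psii psi (Deltai v)))) hw.
apply: (ceq_trans fG e1).
apply: (ceq_trans fG _ (ceq_trans fG e2 _)).
  by apply: (ceq_eq fG) => n; rewrite /D /= DM -!mulrA.
apply: (ceq_trans fG _ (ceq_trans fG e3 _)).
  by apply: (ceq_eq fG) => n; rewrite /D /= DM -!mulrA.
apply: (ceq_trans fG _ (ceq_trans fG e4 _)).
  by apply: (ceq_eq fG) => n; rewrite -!mulrA.
apply: (ceq_trans fG _ e5).
by apply: (ceq_eq fG) => n; rewrite -!mulrA.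
Qed.

End Commutation.

(** * Actions *)

Section TensorAction.
Variables (F : fieldType) (A B : algType F) (L M : lmodType F).
Variables (actL : A -> L -> L) (actM : B -> M -> M).
Hypotheses (HL : is_module actL) (HM : is_module actM).

Let aM b := linear_DZ (module_linr HM b).
Let lL l := linear_DZ (module_linl HL l).
Let lM m := linear_DZ (module_linl HM m).

Let aM0 b : actM b 0 = 0.
Proof. by have := (aM b).2 0 0; rewrite !scale0r. Qed.

Let tL a b : linear (tmap (actL a) (actM b)).
Proof. exact: tmap_linear (module_linr HL a) (module_linr HM b). Qed.

Let tB a b v v' : tmap (actL a) (actM b) (v - v') =
  tmap (actL a) (actM b) v - tmap (actL a) (actM b) v'.
Proof.
have [tD tZ] := linear_DZ (tL a b).
by rewrite -scaleN1r tD tZ scaleN1r.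
Qed.

Let t0 a b : tmap (actL a) (actM b) 0 = 0.
Proof. by have := tB a b 0 0; rewrite !subrr. Qed.

Let tP a b l m : tmap (actL a) (actM b) (tpure l m) = tpure (actL a l) (actM b m).
Proof. exact: tmap_pure (module_linr HL a) (module_linr HM b) l m. Qed.

Lemma tact_balanced v : balanced (fun a b => tmap (actL a) (actM b) v).
Proof.
split=> [a a' b|a b b'|c a b]; elim/tens_ind: v => [|v v' hv hv'|l m].
- by rewrite !t0 addr0.
- by rewrite !tB hv hv' opprD addrACA.
- by rewrite !tP (lL l).1 tpureDl.
- by rewrite !t0 addr0.
- by rewrite !tB hv hv' opprD addrACA.
- by rewrite !tP (lM m).1 tpureDr.
- by rewrite !t0.
- by rewrite !tB hv hv'.
- by rewrite !tP (lL l).2 (lM m).2 tpureZ.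
Qed.

Lemma tact_pure a b v : tact actL actM (tpure a b) v = tmap (actL a) (actM b) v.
Proof. exact: tlift_pure (tact_balanced v) a b. Qed.

Lemma tact_subl x y v :
  tact actL actM (x - y) v = tact actL actM x v - tact actL actM y v.
Proof. exact: tliftB (tact_balanced v) x y. Qed.

Lemma tact_addl x y v :
  tact actL actM (x + y) v = tact actL actM x v + tact actL actM y v.
Proof. exact: tliftD (tact_balanced v) x y. Qed.

Lemma tact0l v : tact actL actM 0 v = 0.
Proof. by have := tact_subl 0 0 v; rewrite !subrr. Qed.

Lemma tact_suml n (X : 'I_n -> tens A B) v :
  tact actL actM (\sum_i X i) v = \sum_i tact actL actM (X i) v.
Proof.
apply: (big_morph (fun x => tact actL actM x v) _ (tact0l v)) => x y.
exact: tact_addl.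
Qed.

Lemma tact_subr x v v' :
  tact actL actM x (v - v') = tact actL actM x v - tact actL actM x v'.
Proof.
elim/tens_ind: x => [|x y hx hy|a b]; first by rewrite !tact0l subrr.
  by rewrite !tact_subl hx hy !opprB addrACA [RHS]addrACA [X in _ + X]addrC.
by rewrite !tact_pure tB.
Qed.

Lemma tact0r x : tact actL actM x 0 = 0.
Proof. by have := tact_subr x 0 0; rewrite !subrr. Qed.

Lemma tactM x y v :
  tact actL actM (x * y) v = tact actL actM x (tact actL actM y v).
Proof.
elim/tens_ind: x => [|x x' hx hx'|a b]; first by rewrite mul0r !tact0l.
  by rewrite mulrBl !tact_subl hx hx'.
elim/tens_ind: y => [|y y' hy hy'|c d]; first by rewrite mulr0 tact0l tact0r.
  by rewrite mulrBr !tact_subl hy hy' tact_subr.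
rewrite tpureM !tact_pure.
elim/tens_ind: v => [|v v' hv hv'|l m]; first by rewrite !t0.
  by rewrite !tB hv hv'.
by rewrite !tP (module_M HL) (module_M HM).
Qed.

(** A two-sided ideal acting by zero. It is described through the second factors and not as a kernel
    of [tact], so that slices along matrix coefficients of [M] vanish on it too. *)
Definition annihilates : tens A B -> Prop :=
  lspan (fun x => exists a b, (forall m, actM b m = 0) /\ x = tpure a b).

Lemma annihilatesMl z x : annihilates x -> annihilates (z * x).
Proof.
elim/tens_ind: z => [|y y' hy hy'|c d] h; first by rewrite mul0r; exact: lspan0.
  by rewrite mulrBl; apply: lspanB; [exact: hy|exact: hy'].
move: h; apply: (lspan_map (mulL_linear _)) => _ [a [b [hb ->]]]; apply: lspan_gen.
exists (c * a), (d * b); rewrite tpureM; split=> // m.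
by rewrite (module_M HM) hb aM0.
Qed.

Lemma annihilatesMr z x : annihilates x -> annihilates (x * z).
Proof.
elim/tens_ind: z => [|y y' hy hy'|c d] h; first by rewrite mulr0; exact: lspan0.
  by rewrite mulrBr; apply: lspanB; [exact: hy|exact: hy'].
move: h; apply: (lspan_map (mulR_linear _)) => _ [a [b [hb ->]]]; apply: lspan_gen.
by exists (a * c), (b * d); rewrite tpureM; split=> // m; rewrite (module_M HM) hb.
Qed.

Lemma annihilates_tact x v : annihilates x -> tact actL actM x v = 0.
Proof.
move=> hx; elim: hx v => [|c _ y [a [b [hb ->]]] _ IH] v; first exact: tact0l.
rewrite tact_addl IH addr0 -tpureZl tact_pure.
elim/tens_ind: v {IH} => [|v v' hv hv'|l m]; first exact: t0.
  by rewrite tB hv hv' subrr.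
by rewrite tP hb tpure0r.
Qed.

End TensorAction.

Section Slice.
Variables (F : fieldType) (A B : lmodType F) (f : B -> F^o).
Hypothesis fL : linear f.

(** The map id (x) f, with A (x) F identified with A. *)
Definition slice : tens A B -> A := tlift (fun a b => (f b : F) *: a).

Let bal : balanced (fun (a : A) b => (f b : F) *: a).
Proof.
have [fD fZ] := linear_DZ fL.
split=> [a a' b|a b b'|c a b]; first by rewrite scalerDr.
  by rewrite fD scalerDl.
by rewrite fZ scalerA mulrC.
Qed.

Lemma slice_pure a b : slice (tpure a b) = (f b : F) *: a.
Proof. exact: tlift_pure bal a b. Qed.

Lemma slice_linear : linear slice.
Proof. by apply: tlift_linear bal _ => c a b; rewrite !scalerA mulrC. Qed.

End Slice.

Import VectorInternalTheory.

(** * Long words in the F_i act by zero on M *)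

Section Nilpotent.
Variables (k : fieldType) (q : k) (r : nat).
Hypotheses (q0 : q != 0) (qI : injective (fun d : int => q ^ d)).
Local Notation U := (U q r).
Variables (M : vectType k) (act : U -> M -> M).
Hypothesis HM : is_module act.

Lemma mul_rV_lin1_fun m n (f : 'rV[k]_m -> 'rV[k]_n) :
  linear f -> forall u, u *m lin1_mx f = f u.
Proof.
move=> fL u.
pose g : {linear 'rV[k]_m -> 'rV[k]_n} :=
  HB.pack f (GRing.isLinear.Build k _ _ _ f fL).
exact: (mul_rV_lin1 g).
Qed.

(** A word of length n acts as an eigenvector of conjugation by K_{2 rho} on matrices, for the
    eigenvalue q^(-2n), or as zero. These values are distinct, so some n gives no eigenvalue. *)
Lemma Fword_act0 : exists n, forall s, size s = n ->
  forall m, act (word (@UF k q r) s) m = 0.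
Proof.
(* Matrices act on row vectors from the right, so [A] reverses products; hence [KrhoV] stands on the
   left in [g]. *)
pose A (x : U) : 'M[k]_(dim M) := lin1_mx (fun u => v2r (act x (r2v u))).
have AE x (u : 'rV_(dim M)) : u *m A x = v2r (act x (r2v u)).
  apply: mul_rV_lin1_fun => c v w.
  by rewrite linearP (module_linr HM) linearP.
have ext (X Y : 'M[k]_(dim M)) : (forall u : 'rV_(dim M), u *m X = u *m Y) -> X = Y.
  by move=> h; apply/row_matrixP => i; rewrite !rowE.
have AM x y : A (x * y) = A y *m A x.
  by apply: ext => u; rewrite mulmxA !AE v2rK (module_M HM).
have AZ c x : A (c *: x) = c *: A x.
  apply: ext => u; rewrite -scalemxAr !AE.
  by rewrite (linear_DZ (module_linl HM _)).2 linearZ.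
pose g := lin_mulmx (A (KrhoV q r)) *m lin_mulmxr (A (Krho q r)) : 'M[k]_(dim M * dim M).
have gE X : mxvec X *m g = mxvec (A (KrhoV q r) *m X *m A (Krho q r)).
  by rewrite mulmxA !mul_vec_lin.
pose lam (n : nat) : k := q ^ (- n.*2%:Z).
have [n nroot] : exists n, ~~ root (char_poly g) (lam n).
  apply: contrapT => h.
  (* As many distinct roots as the size of the polynomial is one more than its degree allows. *)
  have := @max_poly_roots _ (char_poly g) (map lam (iota 0 (size (char_poly g)))).
  rewrite size_map size_iota ltnn monic_neq0 ?char_poly_monic //.
  have -> : all (root (char_poly g)) (map lam (iota 0 (size (char_poly g)))).
    apply/allP => _ /mapP[n _ ->]; apply: contrapT => /negP nr.
    by apply: h; exists n.
  rewrite map_inj_uniq ?iota_uniq; first by move=> /(_ isT isT isT).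
  by move=> a b /qI; lia.
exists n => s sn m; apply: (can_inj v2rK).
rewrite -[m]v2rK -AE linear0; suff -> : A (word (@UF k q r) s) = 0 by rewrite mulmx0.
apply: contraNeq nroot => X0; rewrite -eigenvalue_root_char; apply/eigenvalueP.
exists (mxvec (A (word (@UF k q r) s))); last by rewrite mxvec_eq0.
rewrite gE -mulmxA -!AM -linearZ -AZ /lam -sn.
by have := Fword_adeig (r := r) q0 s; rewrite /adeig => <-.
Qed.

(** In a generator of F_n the word stands on the right and acts first; F_N is contained in F_n. *)
Lemma Ffilt_act0 : exists n, forall N x, (n <= N)%N -> Ffilt N x ->
  forall m, act x m = 0.
Proof.
have [n hn] := Fword_act0; exists n => N x nN hx m.
have {hx} hx : Ffilt n x.
  exact: (filt_le (Ffilt_filtration r q0) nN hx).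
elim: hx => [|c _ z [y [s [sn ->]]] _ IH].
  by rewrite -(scale0r (0 : U)) (linear_DZ (module_linl HM m)).2 scale0r.
have y0 : act y 0 = 0.
  by have := (linear_DZ (module_linr HM y)).2 0 0; rewrite !scale0r.
by rewrite (module_linl HM m) IH addr0 (module_M HM) hn // y0 scaler0.
Qed.

End Nilpotent.

(** * Powers of q and the bar involution of Q(q) *)

Section BarField.

Lemma q_expz_inj : injective (fun d : int => q ^ d).
Proof.
have qn n : q ^+ n = 1 -> n = 0%N.
  rewrite /q -rmorphXn -tofrac1 => /eqP; rewrite tofrac_eq => /eqP e.
  by have := congr1 (fun p : {poly rat} => size p) e; rewrite size_polyXn size_poly1 => -[].
have qz (d : int) : q ^ d = 1 -> d = 0.
  case: d => n; first by rewrite -exprnP => /qn ->.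
  by rewrite NegzE -invr_expz -exprnP => /(congr1 GRing.inv); rewrite invrK invr1 => /qn.
move=> d e /= de; apply/eqP; rewrite -subr_eq0; apply/eqP/qz.
by rewrite expfzDr ?q_neq0 // de -invr_expz mulfV // expfz_neq0 // q_neq0.
Qed.

(** [qbar] fixes rational constants and sends q^-1 to q, so it turns p(q^-1) back into p(q); this
    applies to numerator and denominator. *)
Lemma qbar_involutive : involutive qbar.
Proof.
have bq (c : rat) : qbar (ratQ c) = ratQ c.
  rewrite -[ratQ c in LHS]divr1 -tofrac1 /ratQ /= qbar_frac ?oner_eq0 //.
  by rewrite rmorph1 divr1 /qsubst map_polyC hornerC.
have bs p : qbar (qsubst p) = tofrac p.
  rewrite /qsubst -horner_map /= fmorphV /= qbar_q invrK -map_poly_comp.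
  rewrite (eq_map_poly (g := ratQ)) // /ratQ /= (map_poly_comp (@tofrac {poly rat}) polyC).
  rewrite -/q /q horner_map /= -/(p \Po 'X) comp_polyXr //.
move=> c; have [a [b [b0 ->]]] := fracP c.
by rewrite qbar_frac // fmorph_div /= !bs.
Qed.

End BarField.

(** * Return to U^i (x) U and to the action on L (x) M *)

Section Action.
Variables (k : fieldType) (q : k) (bar : k -> k) (r : nat).
Hypotheses (q0 : q != 0) (qI : injective (fun d : int => q ^ d)).
Hypothesis barK : involutive bar.
Local Notation U := (U q r).
Local Notation Ui := (Ui q r).
Local Notation H := (@Ffilt k q r).
Local Notation G := (tfilt H H).
Variables (L M : vectType k) (actL : Ui -> L -> L) (actM : U -> M -> M).
Hypotheses (HL : is_module actL) (HM : is_module actM).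
Local Notation coord j := (fun m : M => (v2r m 0 j : k^o)).
Local Notation ann := (annihilates (A := Ui) actM).

Let coordL j : linear (coord j).
Proof. by move=> c u v; rewrite linearP !mxE. Qed.

Let coefL m j : linear (fun b => coord j (actM b m)).
Proof. by move=> c u v; rewrite (module_linl HM) coordL. Qed.

(** Slices of tensors over U^i can thus be tested for vanishing inside U, where the filtration is
    separated. *)
Lemma slice_val (m : M) j (z : tens Ui U) :
  val (slice (fun b => coord j (actM b m)) z) =
  slice (fun b => coord j (actM b m)) (tmap val id z).
Proof.
have vL : linear (val : Ui -> U) by [].
have iL : linear (id : U -> U) by [].
pose f := fun b : U => coord j (actM b m).
have [tD tZ] := linear_DZ (tmap_linear vL iL).
have [sD sZ] := linear_DZ (slice_linear (A := U) (coefL m j)).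
have [sD' sZ'] := linear_DZ (slice_linear (A := Ui) (coefL m j)).
apply: (@tens_eq_additive _ _ _ _
  (fun z => val (slice f z)) (fun z => slice f (tmap val id z))).
- by move=> x y; rewrite -scaleN1r sD' sZ' (linear_DZ vL).1 (linear_DZ vL).2 scaleN1r.
- by move=> x y; rewrite -scaleN1r tD tZ sD sZ scaleN1r.
- by move=> a b; rewrite (tmap_pure vL iL) !(slice_pure (coefL m j)) (linear_DZ vL).2.
Qed.

(** Expanding in a basis of [M], the action on [l (x) m] depends only on the slices of [z] along the
    matrix coefficients at [m], which are elements of U^i and act on [L]. *)
Lemma tact_slice (z : tens Ui U) l m :
  tact actL actM z (tpure l m) =
  \sum_j tpure (actL (slice (fun b => coord j (actM b m)) z) l)
               (r2v (delta_mx 0 j)).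
Proof.
pose f j := fun b : U => coord j (actM b m).
apply: (@tens_eq_additive _ _ _ _ (fun z => tact actL actM z (tpure l m))
  (fun z => \sum_j tpure (actL (slice (f j) z) l) (r2v (delta_mx 0 j)))).
- by move=> x y; exact: tact_subl.
- move=> x y; rewrite -sumrB; apply: eq_bigr => j _.
  have [sD sZ] := linear_DZ (slice_linear (A := Ui) (coefL m j)).
  have [aD aZ] := linear_DZ (module_linl HL l).
  rewrite -scaleN1r sD sZ aD aZ tpureDl tpureZl.
  by rewrite scaleN1r.
move=> a b; rewrite tact_pure // (tmap_pure (module_linr HL a) (module_linr HM b)).
rewrite -{1}[actM b m]v2rK [v2r _]row_sum_delta linear_sum /=.
have trL := tpure_linr (V := L) (W := M) (actL a l).
rewrite (big_morph (tpure (actL a l)) (linear_DZ trL).1 (tpure0r _ _)).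
apply: eq_bigr => j _; rewrite linearZ (linear_DZ trL).2 -tpureZl.
rewrite (slice_pure (coefL m j)).
by rewrite (linear_DZ (module_linl HL l)).2.
Qed.

(** Terms of height at least [n0] act by zero, so the sum over all heights has finite support and
    any truncation from [n0] on computes it. *)
Lemma quasiRi_actE (Thetai : nat -> tens Ui U) n0 n :
  (forall N, (n0 <= N)%N -> ann (Thetai N)) -> (n0 <= n)%N ->
  forall x, quasiRi_act actL actM Thetai x =
            tact actL actM (\sum_(N < n) Thetai N) x.
Proof.
move=> hT n0n x; rewrite tact_suml // /quasiRi_act.
rewrite (fsbig_ord _ n (fun N => tact actL actM (Thetai N) x)).
apply/esym/fsbig_widen => // N [_ /= /negP]; rewrite -leqNgt => nN.
by apply: annihilates_tact => //; apply: hT; exact: leq_trans nN.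
Qed.

Theorem tact_quasiRi (Delta : {lrmorphism U -> tens U U})
  (HDelta : is_coproduct Delta)
  (psi : {rmorphism U -> U}) (Hpsi : is_bar bar psi)
  (psii : {rmorphism Ui -> Ui}) (Hpsii : is_ibar bar psii)
  (Deltai : Ui -> tens Ui U) (HDeltai : is_restricted_coproduct Delta Deltai)
  (Upsilon : NPi r -> U) (HUpsilon : is_intertwiner psi psii Upsilon)
  (Upsilon_inv : nat -> U)
  (HUpsilon_inv : cinverse (@Ufilt k q r) (psum Upsilon) Upsilon_inv)
  (Theta : NPi r -> tens U U) (HTheta : is_quasiR Delta psi Theta)
  (Thetai : nat -> tens Ui U)
  (HThetai : is_quasiRi Delta Upsilon Upsilon_inv Theta Thetai) u x :
  tact actL actM (Deltai u) (quasiRi_act actL actM Thetai x) =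
  quasiRi_act actL actM Thetai
    (tact actL actM (bar_coproduct psi psii Deltai u) x).
Proof.
have [n0 hn0] := Ffilt_act0 q0 qI HM.
have Thetai0 N : (n0 <= N)%N -> ann (Thetai N).
  move=> n0N; have [h _] := HThetai; move: (h N).
  apply: lspan_sub => _ [a [b [_ [mu muN hb] ->]]]; apply: lspan_gen; exists a, b.
  split=> // m; apply: (hn0 N) => //; apply: (Uminus_wt_Ffilt q0 qI hb).
  by rewrite muN.
pose B := bar_coproduct psi psii Deltai u.
pose S n := \sum_(N < n) Thetai N.
pose X n := Deltai u * S n - S n * B.
have annS n : (n0 <= n)%N -> ann (S n - S n0).
  move=> n0n; rewrite /S -(subnKC n0n) big_split_ord /= addrAC subrr add0r.
  apply: big_ind => [||N _]; [exact: lspan0 | exact: lspanD |].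
  by apply: Thetai0; rewrite leq_addr.
(* Enlarging the cut-off changes the difference [X] of the two sides only within the ideal [ann],
   hence changes none of its slices. *)
have annX n : (n0 <= n)%N -> ann (X n - X n0).
  move=> /annS h; have -> : X n - X n0 = Deltai u * (S n - S n0) - (S n - S n0) * B.
    by rewrite mulrBr mulrBl /X opprB addrACA opprB [RHS]addrACA [- _ + _]addrC.
  by apply: lspanB; [exact: annihilatesMl | exact: annihilatesMr].
suff X0 y : tact actL actM (X n0) y = 0.
  rewrite !(quasiRi_actE Thetai0 (leqnn n0)) -!tactM //.
  by apply/eqP; rewrite -subr_eq0 -tact_subl // X0.
have vL : linear (val : Ui -> U) by [].
have iL : linear (id : U -> U) by [].
have [tD tZ] := linear_DZ (tmap_linear vL iL).
have tM := tmapM vL iL (fun a b => erefl) (fun a b => erefl).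
have t0 : tmap val id (0 : tens Ui U) = 0 by have := tZ 0 0; rewrite !scale0r.
have tS n : tmap val id (S n) = \sum_(N < n) tmap val id (Thetai N).
  exact: (big_morph _ tD t0).
have tX n : tmap val id (X n) = Delta (val u) * \sum_(N < n) tmap val id (Thetai N)
    - (\sum_(N < n) tmap val id (Thetai N)) * tmap val id B.
  have tB (a b : tens Ui U) : tmap val id (a - b) = tmap val id a - tmap val id b.
    by rewrite -scaleN1r tD tZ scaleN1r.
  have e1 := etrans (tM (Deltai u) (S n)) (congr2 *%R (HDeltai u) (tS n)).
  have e2 := etrans (tM (S n) B) (congr1 ( *%R^~ (tmap val id B)) (tS n)).
  exact: etrans (tB _ _) (congr2 (fun a b => a - b) e1 e2).
have slice0 m j : slice (fun b => coord j (actM b m)) (X n0) = 0.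
  set f := fun b => _; apply: val_inj.
  apply: (Ffilt_separated q0 qI HDelta) => N.
  (* The degree is at least [N], to place the slice in F_N, and at least [n0], so that second
     factors in the filtration act by zero on [M]. *)
  have [n1 hn1] := quasiRi_commutes q0 qI barK HDelta Hpsi Hpsii HDeltai HUpsilon
    HUpsilon_inv HTheta HThetai u (maxn N n0).
  pose n := maxn n0 n1.
  have n0n : (n0 <= n)%N by exact: leq_maxl.
  have [sD sZ] := linear_DZ (slice_linear (A := Ui) (coefL m j)).
  (* The estimate holds only from [n1] on, with [n1] depending on [N]; the slice does not change
     when [n0] is replaced by such an [n]. *)
  have -> : slice f (X n0) = slice f (X n).
    have e : slice f (X n - X n0) = 0.
      elim: (annX n n0n) => [|c _ z [a [b [hb ->]]] _ IH].
        by have := sZ 0 0; rewrite !scale0r.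
      rewrite sD sZ IH addr0 (slice_pure (coefL m j)) /= hb linear0 mxE.
      by rewrite scale0r scaler0.
    by apply/eqP; rewrite eq_sym -subr_eq0 -scaleN1r -sZ -sD scaleN1r e.
  rewrite slice_val tX.
  move: (hn1 n (leq_maxr _ _)); apply: (lspan_map (slice_linear (coefL m j))).
  move=> _ [a [b [hab ->]]]; rewrite (slice_pure (coefL m j)).
  (* Either the slice is a multiple of [a], which lies in F_N, or the matrix coefficient of [b]
     vanishes. *)
  case: hab => [ha|hb].
    apply: lspanZ; apply: (filt_le (Ffilt_filtration r q0) _ ha).
    exact: leq_maxl.
  rewrite (hn0 _ _ (leq_maxr _ _) hb) linear0 mxE scale0r; exact: lspan0.
elim/tens_ind: y => [|y y' hy hy'|l m].
- exact: tact0r.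
- by rewrite tact_subr // hy hy' subrr.
rewrite tact_slice big1 // => j _; rewrite slice0.
have -> : actL 0 l = 0.
  by have := (linear_DZ (module_linl HL l)).2 0 0; rewrite !scale0r.
exact: tpure0l.
Qed.

End Action.

Theorem theorem3p6 (r : nat)
  (Delta : {lrmorphism U q r -> tens (U q r) (U q r)})
  (HDelta : is_coproduct Delta)
  (psi : {rmorphism U q r -> U q r}) (Hpsi : is_bar qbar psi)
  (psii : {rmorphism Ui q r -> Ui q r}) (Hpsii : is_ibar qbar psii)
  (Deltai : Ui q r -> tens (Ui q r) (U q r))
  (HDeltai : is_restricted_coproduct Delta Deltai)
  (Upsilon : NPi r -> U q r) (HUpsilon : is_intertwiner psi psii Upsilon)
  (Upsilon_inv : nat -> U q r)
  (HUpsilon_inv : cinverse (@Ufilt Qq q r) (psum Upsilon) Upsilon_inv)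
  (Theta : NPi r -> tens (U q r) (U q r)) (HTheta : is_quasiR Delta psi Theta)
  (Thetai : nat -> tens (Ui q r) (U q r))
  (HThetai : is_quasiRi Delta Upsilon Upsilon_inv Theta Thetai)
  (L M : vectType Qq) (actL : Ui q r -> L -> L) (actM : U q r -> M -> M)
  (HL : is_module actL) (HM : is_module actM) :
  forall (u : Ui q r) (x : tens L M),
    tact actL actM (Deltai u) (quasiRi_act actL actM Thetai x) =
    quasiRi_act actL actM Thetai
      (tact actL actM (bar_coproduct psi psii Deltai u) x).
Proof.
exact: (tact_quasiRi q_neq0 q_expz_inj qbar_involutive HL HM HDelta Hpsi Hpsii
  HDeltai HUpsilon HUpsilon_inv HTheta HThetai).
Qed.
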